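(* Assume that $\int_0^{K_2}f_2(s)\,ds<0$. Let $R>0$, $A>0$ and $0<l_1<L_1^c$ be fixed, where $$L_1^c=2\sqrt{\frac{d_1}{f_1'(0)}}\,\arctan\left(\sigma\sqrt{\frac{-d_1f_2'(0)}{d_2f_1'(0)}}\right).$$ There exists $\delta>0$ large enough such that the following holds: if $l_2\ge R+2\delta$, and if $u$ is the solution of the patch problem (P) with a nonnegative continuous and compactly supported initial datum $u_0\not\equiv0$ such that $\mathrm{supp}(u_0)$ is included in a bistable (type 2) patch with $\mathrm{diam}(\mathrm{supp}(u_0))\le R$, $\mathrm{dist}(\mathrm{supp}(u_0),S)\ge\delta$ and $\|u_0\|_{L^\infty(\mathbb{R})}\le A$, then $\|u(t,\cdot)\|_{L^\infty(\mathbb{R})}\to0$ as $t\to+\infty$.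
   Context: Setting. Let $l_1,l_2,d_1,d_2,\sigma>0$ and $l=l_1+l_2$; here $d_1,d_2,\sigma,f_1,f_2$ are given. The real line is divided into patches of type 1 (KPP), $(nl-l_1,nl)$, and of type 2 (bistable), $(nl,nl+l_2)$, $n\in\mathbb{Z}$. Set $S_1=l\mathbb{Z}$, $S_2=l\mathbb{Z}+l_2$, $S=S_1\cup S_2$. Let $d(x)=d_1$, $f(x,s)=f_1(s)$ for $x\in(nl-l_1,nl)$ and $d(x)=d_2$, $f(x,s)=f_2(s)$ for $x\in(nl,nl+l_2)$. The functions $f_1,f_2\in C^1(\mathbb{R})$ satisfy, for some $K_1,K_2>0$ and $\theta\in(0,K_2)$: (KPP) $f_1(0)=f_1(K_1)=0$, $0<f_1(s)\le f_1'(0)s$ for $s\in(0,K_1)$, $f_1'(K_1)<0$, $f_1<0$ in $(-\infty,0)\cup(K_1,+\infty)$; (Bistable) $f_2(0)=f_2(\theta)=f_2(K_2)=0$, $f_2'(0)<0$, $f_2'(\theta)>0$, $f_2'(K_2)<0$, $f_2<0$ in $(0,\theta)\cup(K_2,+\infty)$, $f_2>0$ in $(-\infty,0)\cup(\theta,K_2)$. The patch problem (P) is $$\begin{cases}u_t-d(x)u_{xx}=f(x,u), & t>0,\ x\in\mathbb{R}\setminus S,\\ u(t,x^-)=u(t,x^+),\quad u_x(t,x^-)=\sigma u_x(t,x^+), & t>0,\ x\in S_1,\\ u(t,x^-)=u(t,x^+),\quad \sigma u_x(t,x^-)=u_x(t,x^+), & t>0,\ x\in S_2.\end{cases}$$ A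 solution with bounded, nonnegative, continuous initial datum $u_0$ is the (unique) continuous function $u$ on $[0,+\infty)\times\mathbb{R}$, bounded on $[0,T]\times\mathbb{R}$ for all $T>0$, with $u(0,\cdot)=u_0$, which is $C^1$ in $t$ and $C^2$ in $x$ on $(0,+\infty)\times\overline{I}$ for each patch $I$, and satisfies (P) classically. *)

(* Defs.v *)
From Stdlib Require Import Reals.
From Coquelicot Require Import Coquelicot.

Open Scope R_scope.

Definition C1 (f : R -> R) : Prop :=
  forall s, ex_derive f s /\ continuous (Derive f) s.

Definition kpp (f : R -> R) (K : R) : Prop :=
  C1 f /\ 0 < K /\
  f 0 = 0 /\ f K = 0 /\
  (forall s, 0 < s < K -> 0 < f s <= Derive f 0 * s) /\
  Derive f K < 0 /\
  (forall s, s < 0 \/ K < s -> f s < 0).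

Definition bistable (f : R -> R) (theta K : R) : Prop :=
  C1 f /\ 0 < theta < K /\
  f 0 = 0 /\ f theta = 0 /\ f K = 0 /\
  Derive f 0 < 0 /\ 0 < Derive f theta /\ Derive f K < 0 /\
  (forall s, 0 < s < theta \/ K < s -> f s < 0) /\
  (forall s, s < 0 \/ theta < s < K -> 0 < f s).

Definition L1c (d1 d2 sigma : R) (f1 f2 : R -> R) : R :=
  2 * sqrt (d1 / Derive f1 0)
    * atan (sigma * sqrt ((- d1 * Derive f2 0) / (d2 * Derive f1 0))).

Definition patch1 (l1 l2 : R) (n : Z) (x : R) : Prop :=
  IZR n * (l1 + l2) - l1 < x < IZR n * (l1 + l2).
Definition patch2 (l1 l2 : R) (n : Z) (x : R) : Prop :=
  IZR n * (l1 + l2) < x < IZR n * (l1 + l2) + l2.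

Definition S1 (l1 l2 x : R) : Prop := exists n : Z, x = IZR n * (l1 + l2).
Definition S2 (l1 l2 x : R) : Prop := exists n : Z, x = IZR n * (l1 + l2) + l2.
Definition S12 (l1 l2 x : R) : Prop := S1 l1 l2 x \/ S2 l1 l2 x.

(* Derivative of [g] at [x] relative to [[a, b]]: one-sided at the endpoints. *)
Definition is_derive_within (a b : R) (g : R -> R) (x l : R) : Prop :=
  filterdiff g (within (fun y => a <= y <= b) (locally x)) (fun h => scal h l).

(* [u] is of class C^{1;2}_{t;x} on (0,+oo) x [a, b], endpoints included:
   the derivatives exist and are jointly continuous there. *)
Definition C12 (a b : R) (u : R -> R -> R) : Prop :=
  exists ut ux uxx : R -> R -> R,
    (forall t x, 0 < t -> a <= x <= b ->
       is_derive (fun s => u s x) t (ut t x) /\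
       is_derive_within a b (u t) x (ux t x) /\
       is_derive_within a b (ux t) x (uxx t x)) /\
    let D := fun p : R * R => 0 < fst p /\ a <= snd p <= b in
    continuous_on D (fun p => ut (fst p) (snd p)) /\
    continuous_on D (fun p => ux (fst p) (snd p)) /\
    continuous_on D (fun p => uxx (fst p) (snd p)).

(* [gm = g(x^-)] and [gp = g(x^+)]. *)
Definition one_sided_limits (g : R -> R) (x gm gp : R) : Prop :=
  filterlim g (at_left x) (locally gm) /\
  filterlim g (at_right x) (locally gp).

Definition patch_problem (d1 d2 sigma : R) (f1 f2 : R -> R) (l1 l2 : R)
    (u : R -> R -> R) : Prop :=
  forall t, 0 < t ->
    (forall n x, patch1 l1 l2 n x ->
       Derive (fun s => u s x) t - d1 * Derive_n (u t) 2 x = f1 (u t x)) /\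
    (forall n x, patch2 l1 l2 n x ->
       Derive (fun s => u s x) t - d2 * Derive_n (u t) 2 x = f2 (u t x)) /\
    (forall x, S1 l1 l2 x ->
       exists um up vm vp,
         one_sided_limits (u t) x um up /\
         one_sided_limits (Derive (u t)) x vm vp /\
         um = up /\ vm = sigma * vp) /\
    (forall x, S2 l1 l2 x ->
       exists um up vm vp,
         one_sided_limits (u t) x um up /\
         one_sided_limits (Derive (u t)) x vm vp /\
         um = up /\ sigma * vm = vp).

(* Values of [u] at negative times are irrelevant. *)
Definition is_solution (d1 d2 sigma : R) (f1 f2 : R -> R) (l1 l2 : R)
    (u0 : R -> R) (u : R -> R -> R) : Prop :=
  continuous_on (fun p : R * R => 0 <= fst p) (fun p => u (fst p) (snd p)) /\
  (forall T, 0 < T ->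
     exists M, forall t x, 0 <= t <= T -> Rabs (u t x) <= M) /\
  (forall x, u 0 x = u0 x) /\
  (forall n : Z,
     C12 (IZR n * (l1 + l2) - l1) (IZR n * (l1 + l2)) u /\
     C12 (IZR n * (l1 + l2)) (IZR n * (l1 + l2) + l2) u) /\
  patch_problem d1 d2 sigma f1 f2 l1 l2 u.

Definition supp (g : R -> R) : R -> Prop := adherence (fun x => g x <> 0).

Definition diam (E : R -> Prop) : Rbar :=
  Lub_Rbar (fun r => exists x y, E x /\ E y /\ r = Rabs (x - y)).

Definition dist_sets (E F : R -> Prop) : Rbar :=
  Glb_Rbar (fun r => exists x y, E x /\ F y /\ r = Rabs (x - y)).

(* Supremum norm; it is the L^oo norm for the continuous functions to which
   it is applied, and is [p_infty] for unbounded ones. *)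
Definition norm_Linf (g : R -> R) : Rbar :=
  Lub_Rbar (fun r => exists x, r = Rabs (g x)).

(* Main.v *)
Require Import Defs.
From Stdlib Require Import Reals Lra Lia ZArith Classical ClassicalEpsilon.
From Coquelicot Require Import Coquelicot.
Open Scope R_scope.

(** The solution is trapped between 0 and the explicit barrier
    [U (|x - x0| - rho + c t) + eps exp (- lam t) phi x], where [x0] is any point
    of the support of the datum; the barrier tends to 0 uniformly in [x].

    The front [U].  Since the integral of [f2] over [[0, K2]] is negative, the
    potential [G s = RInt f2 0 s] lies below a negative multiple of [s ^ 2] on any
    interval [[0, B]] ([negative_energy]).  Hence [Q s = - G s - kap s ^ 2] is
    positive, and the first-order equation [U' = - sqrt (2 Q (U) / d2)] has a
    decreasing positive solution starting from the height
    [M = max (A, K1, K2)], which the solution never exceeds.  It decays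
    exponentially and satisfies [d2 U'' + f2 (U) = - 2 kap U]
    ([retreating_profile]).  The surplus [2 kap U] pays for a small speed [c]: two
    facing copies of the front close in on [x0], so the bump is erased whatever
    its height.

    The weight [phi].  Put [a1 = f1'(0)] and [a2 = - f2'(0)].  The assumption on
    [l1] says that [om tan (om l1 / 2) < sigma be] for [om = sqrt (a1 / d1)] and
    [be = sqrt (a2 / d2)].  The inequality survives a slight increase of [om] and
    decrease of [be], so a cosine of frequency [om] in the KPP patches matches
    exponentials of rate [be] in the bistable ones with a flux jump of the
    favourable sign, bounded away from 0.  Thus [exp (- lam t) phi] is a
    supersolution of the problem linearized at 0, with a margin in the KPP patches
    and at the interfaces that does not depend on [l2] ([weight_exists]).

    Their sum.  In a bistable patch either both terms are small, where [f2]
    decreases at a rate above [mu2], or the front is not small and its surplus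
    absorbs the small tail.  In the KPP patches and at the interfaces the front is
    at most [M exp (- m (delta - rho)) exp (- lam t)]; for [delta] large, what it
    contributes to the reaction and to the flux is absorbed by the margins of
    [phi] ([branch_satisfies]).

    Comparison ([comparison]) holds on the whole line although the functions
    have kinks at the interfaces.  Adding
    [eta exp (K t) phi x (1 + nu ^ 2 x ^ 2)] makes a supersolution strict, at the
    interfaces too, and large at infinity.  Then there is a first contact if there
    is any ([first_contact]), and at it the strict inequalities contradict the
    order of the derivatives ([no_contact]).  Letting [eta] tend to 0 concludes.
    The kink of the barrier at [x0] is concave, hence harmless: there the barrier
    is touched from above by one of its two smooth branches. *)

(** * One-sided slopes, second derivatives and contact *)

(** Along [at_left x] and [at_right x] this gives the one-sided derivatives, the
    only ones that exist at an interface. *)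
Definition slope (F : (R -> Prop) -> Prop) (g : R -> R) (x a : R) : Prop :=
  filterlim (fun y => (g y - g x) / (y - x)) F (locally a).

Definition derive2 (g : R -> R) (x a b : R) : Prop :=
  exists g' : R -> R,
    locally x (fun y => is_derive g y (g' y)) /\ g' x = a /\ is_derive g' x b.

Lemma locally'_of_left (x : R) (P : R -> Prop) : locally' x P -> at_left x P.
Proof.
intros [e He]; exists e; intros y Hy Hlt.
apply He; [exact Hy|lra].
Qed.

Lemma locally'_of_right (x : R) (P : R -> Prop) : locally' x P -> at_right x P.
Proof.
intros [e He]; exists e; intros y Hy Hlt.
apply He; [exact Hy|lra].
Qed.

Lemma slope_of_derive (F : (R -> Prop) -> Prop) {FF : Filter F} (g : R -> R) (x a : R) :
  (forall P, locally' x P -> F P) -> is_derive g x a -> slope F g x a.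
Proof.
intros HF Hg.
apply is_derive_Reals in Hg.
apply filterlim_locally; intros eps.
destruct (Hg eps (cond_pos eps)) as [e He].
apply HF; exists e; intros y Hy Hne.
assert (H := He (y - x)).
rewrite Rplus_minus in H.
apply H; [apply Rminus_eq_contra; exact Hne|exact Hy].
Qed.

Lemma slope_left_of_derive (g : R -> R) (x a : R) : is_derive g x a -> slope (at_left x) g x a.
Proof. apply slope_of_derive; [typeclasses eauto | apply locally'_of_left]. Qed.

Lemma slope_right_of_derive (g : R -> R) (x a : R) : is_derive g x a -> slope (at_right x) g x a.
Proof. apply slope_of_derive; [typeclasses eauto | apply locally'_of_right]. Qed.

Lemma slope_ext (F : (R -> Prop) -> Prop) {FF : Filter F} (g h : R -> R) (x a : R) :
  F (fun y => g y = h y) -> g x = h x -> slope F g x a -> slope F h x a.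
Proof.
intros HF Hx; apply filterlim_ext_loc.
revert HF; apply filter_imp; intros y ->; now rewrite Hx.
Qed.

Lemma filterlim_Rplus {T} (F : (T -> Prop) -> Prop) {FF : Filter F} (f g : T -> R) (a b : R) :
  filterlim f F (locally a) -> filterlim g F (locally b) ->
  filterlim (fun y => f y + g y) F (locally (a + b)).
Proof.
intros Hf Hg.
exact (filterlim_comp_2 f g plus Hf Hg (filterlim_plus a b)).
Qed.

Lemma filterlim_Rmult {T} (F : (T -> Prop) -> Prop) {FF : Filter F} (f g : T -> R) (a b : R) :
  filterlim f F (locally a) -> filterlim g F (locally b) ->
  filterlim (fun y => f y * g y) F (locally (a * b)).
Proof.
intros Hf Hg.
exact (filterlim_comp_2 f g mult Hf Hg (filterlim_mult a b)).
Qed.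

Lemma slope_plus (F : (R -> Prop) -> Prop) {FF : Filter F} (g h : R -> R) (x a b : R) :
  slope F g x a -> slope F h x b -> slope F (fun y => g y + h y) x (a + b).
Proof.
intros Hg Hh.
apply filterlim_ext with
  (fun y => (g y - g x) / (y - x) + (h y - h x) / (y - x)).
  intros y; unfold Rdiv; ring.
now apply (filterlim_Rplus F).
Qed.

Lemma slope_opp (F : (R -> Prop) -> Prop) {FF : Filter F} (g : R -> R) (x a : R) :
  slope F g x a -> slope F (fun y => - g y) x (- a).
Proof.
intros Hg.
apply filterlim_ext with (fun y => opp ((g y - g x) / (y - x))).
  intros y; unfold opp; simpl; unfold Rdiv; ring.
exact (filterlim_comp _ _ _ _ _ _ _ _ Hg (filterlim_opp a)).
Qed.

Lemma slope_mult (F : (R -> Prop) -> Prop) {FF : Filter F} (g h : R -> R) (x a b : R) :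
  (forall P, locally' x P -> F P) ->
  slope F g x a -> is_derive h x b ->
  slope F (fun y => g y * h y) x (a * h x + g x * b).
Proof.
intros HF Hg Hh.
apply filterlim_ext with
  (fun y => (g y - g x) / (y - x) * h y + g x * ((h y - h x) / (y - x))).
  intros y; unfold Rdiv; ring.
assert (Hhx : filterlim h F (locally (h x))).
{ intros P HP; apply HF.
  destruct (ex_derive_continuous h x (ex_intro _ b Hh) P HP) as [e He].
  exists e; intros y Hy _; now apply He. }
apply (filterlim_Rplus F); apply (filterlim_Rmult F); trivial.
- apply filterlim_const.
- now apply slope_of_derive.
Qed.

(** To the left of a contact point the difference quotients have a negative
    denominator, which reverses the order of the functions. *)
Lemma slope_left_contact (u w : R -> R) (x a b : R) :
  (at_left x (fun y => u y <= w y)) -> u x = w x ->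
  slope (at_left x) u x a -> slope (at_left x) w x b -> b <= a.
Proof.
intros Hle Hx Ha Hb.
apply (filterlim_le (F := at_left x) _ _ (Finite b) (Finite a)) with (2 := Hb) (3 := Ha).
destruct Hle as [e He]; exists e; intros y Hy Hlt.
assert (H := He y Hy Hlt).
rewrite Hx.
assert (0 < x - y) by lra.
replace ((w y - w x) / (y - x)) with ((w x - w y) / (x - y)) by (field; lra).
replace ((u y - w x) / (y - x)) with ((w x - u y) / (x - y)) by (field; lra).
apply Rmult_le_compat_r; [|lra].
now apply Rlt_le, Rinv_0_lt_compat.
Qed.

Lemma slope_right_contact (u w : R -> R) (x a b : R) :
  (at_right x (fun y => u y <= w y)) -> u x = w x ->
  slope (at_right x) u x a -> slope (at_right x) w x b -> a <= b.
Proof.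
intros Hle Hx Ha Hb.
apply (filterlim_le (F := at_right x) _ _ (Finite a) (Finite b)) with (2 := Ha) (3 := Hb).
destruct Hle as [e He]; exists e; intros y Hy Hlt.
assert (H := He y Hy Hlt).
rewrite Hx.
apply Rmult_le_compat_r; [|lra].
apply Rlt_le, Rinv_0_lt_compat; lra.
Qed.

Lemma derive2_plus (g h : R -> R) (x a b a' b' : R) :
  derive2 g x a b -> derive2 h x a' b' ->
  derive2 (fun y => g y + h y) x (a + a') (b + b').
Proof.
intros [g' [Hg [<- Hg']]] [h' [Hh [<- Hh']]].
exists (fun y => g' y + h' y); split; [|split].
- generalize (filter_and _ _ Hg Hh); apply filter_imp; intros y [H1 H2].
  now apply (is_derive_plus g h).
- reflexivity.
- now apply (is_derive_plus g' h').
Qed.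

Lemma derive2_opp (g : R -> R) (x a b : R) :
  derive2 g x a b -> derive2 (fun y => - g y) x (- a) (- b).
Proof.
intros [g' [Hg [<- Hg']]].
exists (fun y => - g' y); split; [|split].
- revert Hg; apply filter_imp; intros y H1.
  now apply (is_derive_opp g).
- reflexivity.
- now apply (is_derive_opp g').
Qed.

Lemma derive2_mult (g h : R -> R) (x a b a' b' : R) :
  derive2 g x a b -> derive2 h x a' b' ->
  derive2 (fun y => g y * h y) x (a * h x + g x * a')
    (b * h x + 2 * (a * a') + g x * b').
Proof.
intros [g' [Hg [<- Hg']]] [h' [Hh [<- Hh']]].
exists (fun y => g' y * h y + g y * h' y); split; [|split].
- generalize (filter_and _ _ Hg Hh); apply filter_imp; intros y [H1 H2].
  apply (is_derive_mult g h); try assumption; intros; apply Rmult_comm.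
- reflexivity.
- apply locally_singleton in Hg; apply locally_singleton in Hh.
  replace (b * h x + 2 * (g' x * h' x) + g x * b') with
    ((b * h x + g' x * h' x) + (g' x * h' x + g x * b')) by ring.
  apply (is_derive_plus (fun y => g' y * h y) (fun y => g y * h' y)).
  + apply (is_derive_mult g' h); try assumption; intros; apply Rmult_comm.
  + apply (is_derive_mult g h'); try assumption; intros; apply Rmult_comm.
Qed.

Lemma derive2_const c x : derive2 (fun _ => c) x 0 0.
Proof.
exists (fun _ => 0); split; [|split; [reflexivity|]].
- apply filter_forall; intros y; apply (is_derive_const c).
- apply (is_derive_const 0).
Qed.

Lemma derive2_ext_loc (g h : R -> R) (x a b : R) :
  locally x (fun y => g y = h y) -> derive2 g x a b -> derive2 h x a b.
Proof.
intros Hl [g' [Hg [Ha Hg']]]; exists g'; split; [|split; trivial].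
apply locally_locally in Hl.
generalize (filter_and _ _ Hl Hg); apply filter_imp; intros y [H1 H2].
now apply is_derive_ext_loc with g.
Qed.

(** Both one-sided slopes give [a = 0].  Were [b] negative, the derivative would
    be negative just to the right of [x], and the mean value theorem would make [h]
    negative there. *)
Lemma derive2_min (h : R -> R) (x a b : R) :
  locally x (fun y => 0 <= h y) -> h x = 0 -> derive2 h x a b -> 0 <= b.
Proof.
intros Hpos Hx [h' [Hd [Ha Hd']]].
assert (Hdx := locally_singleton _ _ Hd).
assert (Hl0 : h' x <= 0).
  apply (slope_left_contact (fun _ => 0) h x) ; try easy.
  - apply locally'_of_left. destruct Hpos as [e He]; exists e; auto.
  - apply slope_left_of_derive, (is_derive_const 0).
  - now apply slope_left_of_derive.
assert (Hr0 : 0 <= h' x).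
  apply (slope_right_contact (fun _ => 0) h x) ; try easy.
  - apply locally'_of_right. destruct Hpos as [e He]; exists e; auto.
  - apply slope_right_of_derive, (is_derive_const 0).
  - now apply slope_right_of_derive.
assert (H0 : h' x = 0) by lra.
destruct (Rle_or_lt 0 b) as [|Hb]; [assumption|exfalso].
apply is_derive_Reals in Hd'.
destruct (Hd' (- b)) as [e He]; [lra|].
destruct Hd as [e1 Hd], Hpos as [e2 Hpos].
set (r := Rmin e (Rmin e1 e2) / 2).
assert (Hr : 0 < r /\ r < e /\ r < e1 /\ r < e2).
{ assert (He0 := cond_pos e); assert (He1 := cond_pos e1); assert (He2 := cond_pos e2).
  assert (H1 := Rmin_l e (Rmin e1 e2)). assert (H2 := Rmin_r e (Rmin e1 e2)).
  assert (H3 := Rmin_l e1 e2). assert (H4 := Rmin_r e1 e2).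
  assert (0 < Rmin e (Rmin e1 e2)) by (repeat apply Rmin_glb_lt; assumption).
  unfold r; lra. }
assert (Hneg : forall y, x < y <= x + r -> h' y < 0).
{ intros y Hy.
  assert (Hq := He (y - x)).
  rewrite Rplus_minus in Hq.
  rewrite H0, Rminus_0_r in Hq.
  assert (Habs : Rabs (y - x) < e) by (rewrite Rabs_pos_eq; lra).
  specialize (Hq ltac:(lra) Habs).
  apply Rabs_def2 in Hq.
  assert (Hq' : h' y / (y - x) < 0) by lra.
  replace (h' y) with (h' y / (y - x) * (y - x)) by (field; lra).
  nra. }
assert (Hball : forall y, x <= y <= x + r -> Rabs (y - x) < e1 /\ Rabs (y - x) < e2).
{ intros y Hy; rewrite Rabs_pos_eq; lra. }
destruct (MVT_cor2 h h' x (x + r)) as [c [Hc1 Hc2]]; [lra| |].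
- intros y Hy; apply is_derive_Reals, Hd, (proj1 (Hball y Hy)).
- assert (Hxr : 0 <= h (x + r)) by (apply Hpos, Hball; lra).
  assert (h' c < 0) by (apply Hneg; lra).
  nra.
Qed.

Lemma derive2_contact (u w : R -> R) (x a b a' b' : R) :
  locally x (fun y => u y <= w y) -> u x = w x ->
  derive2 u x a b -> derive2 w x a' b' -> b <= b'.
Proof.
intros Hl Hx Hu Hw.
assert (H := derive2_plus _ _ _ _ _ _ _ Hw (derive2_opp _ _ _ _ Hu)).
apply derive2_min in H; [lra| |lra].
revert Hl; apply filter_imp; intros y; lra.
Qed.

Lemma slope_scal (F : (R -> Prop) -> Prop) {FF : Filter F} (g : R -> R) (x a c : R) :
  slope F g x a -> slope F (fun y => c * g y) x (c * a).
Proof.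
intros Hg.
apply filterlim_ext with (fun y => c * ((g y - g x) / (y - x))).
  intros y; unfold Rdiv; ring.
apply (filterlim_Rmult F); [apply filterlim_const|exact Hg].
Qed.

Lemma derive2_scal (g : R -> R) (x a b c : R) :
  derive2 g x a b -> derive2 (fun y => c * g y) x (c * a) (c * b).
Proof.
intros [g' [Hg [<- Hg']]].
exists (fun y => c * g' y); split; [|split].
- revert Hg; apply filter_imp; intros y H1; now apply (is_derive_scal g).
- reflexivity.
- now apply (is_derive_scal g').
Qed.

Lemma is_derive_exp_scal (a t : R) : is_derive (fun s => exp (a * s)) t (a * exp (a * t)).
Proof. auto_derive; [trivial|ring]. Qed.

Lemma is_derive_shift (g : R -> R) (c x a : R) :
  is_derive g (x - c) a -> is_derive (fun y => g (y - c)) x a.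
Proof.
intros Hg.
replace a with (scal 1 a) by (unfold scal; simpl; unfold mult; simpl; ring).
apply (is_derive_comp g (fun y => y - c)); [assumption|].
auto_derive; [trivial|ring].
Qed.

Lemma locally_between (a b x : R) (P : R -> Prop) : a < x < b ->
  (forall y, a <= y <= b -> P y) -> locally x P.
Proof.
intros Hx HP.
assert (He : 0 < Rmin (x - a) (b - x)) by (apply Rmin_glb_lt; lra).
exists (mkposreal _ He); intros y Hy.
unfold ball in Hy; simpl in Hy; unfold AbsRing_ball, abs, minus, plus, opp in Hy.
simpl in Hy; apply Rabs_def2 in Hy.
assert (H1 := Rmin_l (x - a) (b - x)); assert (H2 := Rmin_r (x - a) (b - x)).
apply HP; lra.
Qed.

Lemma at_left_between (a x : R) (P : R -> Prop) : a < x ->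
  (forall y, a <= y <= x -> P y) -> at_left x P.
Proof.
intros Hx HP.
change (locally x (fun y => y < x -> P y)).
apply (locally_between a (x + 1) x); [lra|].
intros y Hy Hlt; apply HP; lra.
Qed.

Lemma at_right_between (b x : R) (P : R -> Prop) : x < b ->
  (forall y, x <= y <= b -> P y) -> at_right x P.
Proof.
intros Hx HP.
change (locally x (fun y => x < y -> P y)).
apply (locally_between (x - 1) b x); [lra|].
intros y Hy Hlt; apply HP; lra.
Qed.

Lemma slope_continuous (F : (R -> Prop) -> Prop) {FF : Filter F} (g : R -> R) (x a : R) :
  (forall P, locally' x P -> F P) -> slope F g x a -> filterlim g F (locally (g x)).
Proof.
intros HF Hg.
assert (H : filterlim (fun y => g x + (g y - g x) / (y - x) * (y - x)) F
              (locally (g x + a * 0))).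
{ apply (filterlim_Rplus F); [apply filterlim_const|].
  apply (filterlim_Rmult F); [exact Hg|].
  intros P HP; apply HF.
  assert (Hc : continuous (fun y => y - x) x).
  { apply (ex_derive_continuous (fun y => y - x)); auto_derive; trivial. }
  unfold continuous in Hc; rewrite Rminus_diag in Hc.
  destruct (Hc P HP) as [e He]; exists e; intros y Hy _; now apply He. }
replace (g x + a * 0) with (g x) in H by ring.
apply filterlim_ext_loc with (2 := H).
apply HF; exists (mkposreal 1 Rlt_0_1); intros y _ Hne.
assert (y - x <> 0) by now apply Rminus_eq_contra.
field; assumption.
Qed.

Lemma continuous_sides (g : R -> R) (x a b : R) :
  slope (at_left x) g x a -> slope (at_right x) g x b -> continuous g x.
Proof.
intros Ha Hb P HP.
destruct (slope_continuous (at_left x) g x a (locally'_of_left x) Ha P HP) as [e1 H1].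
destruct (slope_continuous (at_right x) g x b (locally'_of_right x) Hb P HP) as [e2 H2].
assert (He : 0 < Rmin e1 e2) by (apply Rmin_glb_lt; apply cond_pos).
exists (mkposreal _ He); intros y Hy.
destruct (Rtotal_order y x) as [Hlt|[->|Hgt]].
- apply H1; [|assumption]. apply Rlt_le_trans with (1 := Hy), Rmin_l.
- now apply locally_singleton in HP.
- apply H2; [|assumption]. apply Rlt_le_trans with (1 := Hy), Rmin_r.
Qed.

Lemma derive2_continuous (g : R -> R) (x a b : R) : derive2 g x a b -> continuous g x.
Proof.
intros [g' [Hg _]]; apply locally_singleton in Hg.
apply (ex_derive_continuous g); now exists (g' x).
Qed.

(** * Continuity in time and space, and the first contact *)

Definition continuous_future (h : R -> R -> R) : Prop :=
  continuous_on (fun p : R * R => 0 <= fst p) (fun p => h (fst p) (snd p)).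

Lemma continuous_future_pos h t x : continuous_future h -> 0 <= t -> 0 < h t x ->
  exists d : posreal, forall s y, 0 <= s -> Rabs (s - t) < d -> Rabs (y - x) < d ->
    0 < h s y.
Proof.
intros Hc Ht Hh.
assert (Ho : locally (h t x) (fun r => 0 < r)) by now apply open_gt.
destruct (Hc (t, x) Ht _ Ho) as [d Hd].
exists d; intros s y Hs H1 H2.
now apply (Hd (s, y)); [split|].
Qed.

Lemma continuous_future_opp h : continuous_future h ->
  continuous_future (fun t x => - h t x).
Proof.
intros Hc p Hp.
exact (filterlim_comp _ _ _ _ _ _ _ _ (Hc p Hp) (filterlim_opp (h (fst p) (snd p)))).
Qed.

Lemma continuous_future_plus h k : continuous_future h -> continuous_future k ->
  continuous_future (fun t x => h t x + k t x).
Proof.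
intros Hh Hk p Hp.
apply (filterlim_Rplus _ (fun p => h (fst p) (snd p)) (fun p => k (fst p) (snd p)));
  [now apply Hh|now apply Hk].
Qed.

Lemma continuous_future_mult h k : continuous_future h -> continuous_future k ->
  continuous_future (fun t x => h t x * k t x).
Proof.
intros Hh Hk p Hp.
apply (filterlim_Rmult _ (fun p => h (fst p) (snd p)) (fun p => k (fst p) (snd p)));
  [now apply Hh|now apply Hk].
Qed.

Lemma continuous_future_time g : (forall t, continuous g t) ->
  continuous_future (fun t _ => g t).
Proof.
intros Hg [t x] _ P HP.
destruct (Hg t P HP) as [d Hd].
exists d; intros [s y] [H1 _] _; exact (Hd s H1).
Qed.

Lemma continuous_future_space g : (forall x, continuous g x) ->
  continuous_future (fun _ x => g x).
Proof.
intros Hg [t x] _ P HP.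
destruct (Hg x P HP) as [d Hd].
exists d; intros [s y] [_ H1] _; exact (Hd y H1).
Qed.

Lemma continuous_future_comp g h : (forall r, continuous g r) -> continuous_future h ->
  continuous_future (fun t x => g (h t x)).
Proof.
intros Hg Hh p Hp.
exact (filterlim_comp _ _ _ _ _ _ _ _ (Hh p Hp) (Hg (h (fst p) (snd p)))).
Qed.

(** Positivity at far points holds by hypothesis, and on the remaining compact
    interval it persists for a short time by compactness; so at the
    supremum of the times up to which [h] is positive, [h] has a zero and has not yet
    been negative anywhere. *)
Lemma first_contact (h : R -> R -> R) (T N : R) :
  continuous_future h ->
  (forall x, 0 < h 0 x) ->
  (forall t x, 0 <= t <= T -> N <= Rabs x -> 0 < h t x) ->
  (forall t x, 0 < t <= T -> h t x = 0 ->
     (forall s y, 0 <= s <= t -> 0 <= h s y) -> False) ->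
  forall t x, 0 <= t <= T -> 0 < h t x.
Proof.
intros Hc H0 Hfar Hno t1 x1 Ht1.
destruct (Rlt_or_le 0 (h t1 x1)) as [|Hneg]; [assumption|exfalso].
set (E := fun t => 0 <= t <= T /\ forall s y, 0 <= s <= t -> 0 < h s y).
destruct (completeness E) as [t0 [Hub Hlub]].
{ exists T; intros t [Ht _]; lra. }
{ exists 0; split; [lra|]. intros s y Hs; replace s with 0 by lra; apply H0. }
assert (Ht0 : 0 <= t0 <= T).
{ split.
  - apply Hub; split; [lra|]. intros s y Hs; replace s with 0 by lra; apply H0.
  - apply Hlub; intros t [Ht _]; lra. }
assert (Hbefore : forall s y, 0 <= s < t0 -> 0 < h s y).
{ intros s y Hs.
  destruct (classic (exists t, E t /\ s <= t)) as [[t [[_ Ht] Hst]]|Hn].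
  - apply Ht; lra.
  - exfalso. assert (t0 <= s); [|lra].
    apply Hlub; intros t Ht; destruct (Rle_or_lt t s) as [|Hlt]; [assumption|].
    exfalso; apply Hn; exists t; split; [assumption|lra]. }
assert (Hat : forall y, 0 < t0 -> 0 <= h t0 y).
{ intros y Hpos; destruct (Rle_or_lt 0 (h t0 y)) as [|Hlt]; [assumption|exfalso].
  destruct (continuous_future_pos _ t0 y (continuous_future_opp _ Hc)) as [d Hd];
    [lra|lra|].
  assert (Hd0 := cond_pos d).
  set (s := Rmax 0 (t0 - d / 2)).
  assert (Hs : 0 <= s < t0 /\ t0 - d / 2 <= s).
  { unfold s; split; [split|]; [apply Rmax_l|apply Rmax_lub_lt; lra|apply Rmax_r]. }
  assert (H1 := Hbefore s y (proj1 Hs)).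
  assert (H2 := Hd s y ltac:(lra)).
  rewrite Rabs_left in H2 by lra.
  rewrite Rminus_diag, Rabs_R0 in H2.
  specialize (H2 ltac:(lra) Hd0); lra. }
(* Compactness in space: positivity at time t0 persists for a short while. *)
assert (Hex : exists y, h t0 y <= 0).
{ apply NNPP; intros Hn.
  assert (Hall : forall y, 0 < h t0 y).
  { intros y; apply Rnot_le_lt; intros Hy; apply Hn; now exists y. }
  assert (Htube : exists d : posreal, forall s y, 0 <= s <= T -> Rabs (s - t0) < d ->
             0 < h s y).
  { assert (Hd : forall y, {d : posreal | forall s z, 0 <= s -> Rabs (s - t0) < d ->
               Rabs (z - y) < d -> 0 < h s z}).
    { intros y; apply constructive_indefinite_description.
      apply continuous_future_pos; [assumption|lra|apply Hall]. }
    destruct (compactness_value_1d (- N) N (fun y => proj1_sig (Hd y))) as [d Hd'].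
    exists d; intros s y Hs Hsd.
    destruct (Rle_or_lt N (Rabs y)) as [Hy|Hy]; [apply Hfar; assumption|].
    apply Rabs_lt_between in Hy.
    destruct (Rlt_or_le 0 (h s y)) as [|Hle]; [assumption|exfalso].
    apply (Hd' y); [lra|]. intros [z [_ [Hz1 Hz2]]].
    assert (H := proj2_sig (Hd z) s y ltac:(lra) ltac:(lra) Hz1). lra. }
  destruct Htube as [d Hd]; assert (Hd0 := cond_pos d).
  destruct (Rle_or_lt (t0 + d / 2) T) as [HT|HT].
  - assert (t0 + d / 2 <= t0); [|lra].
    apply Hub; split; [lra|]. intros s y Hs.
    destruct (Rlt_or_le s t0) as [Hlt|Hge]; [apply Hbefore; lra|].
    apply Hd; [lra|]. rewrite Rabs_pos_eq; lra.
  - assert (0 < h t1 x1); [|lra].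
    destruct (Rlt_or_le t1 t0) as [Hlt|Hge]; [apply Hbefore; lra|].
    apply Hd; [lra|]. rewrite Rabs_pos_eq; lra. }
destruct Hex as [y Hy].
assert (Hpos : 0 < t0).
{ destruct (Req_dec t0 0) as [E0|]; [|lra]. rewrite E0 in Hy; specialize (H0 y); lra. }
apply (Hno t0 y); [lra| |].
- specialize (Hat y Hpos); lra.
- intros s z Hs; destruct (Rlt_or_le s t0) as [Hlt|Hge].
  + apply Rlt_le, Hbefore; lra.
  + replace s with t0 by lra; now apply Hat.
Qed.

(** * Sub- and supersolutions at a point *)

Lemma patch_cover (l1 l2 x : R) : 0 < l1 -> 0 < l2 ->
  (exists n, patch1 l1 l2 n x) \/ (exists n, patch2 l1 l2 n x) \/
  S1 l1 l2 x \/ S2 l1 l2 x.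
Proof.
intros Hl1 Hl2.
destruct (floor_ex (x / (l1 + l2))) as [n [Hn1 Hn2]].
assert (Hx : x = x / (l1 + l2) * (l1 + l2)) by (field; lra).
set (q := x / (l1 + l2)) in *.
assert (H1 : IZR n * (l1 + l2) <= x) by (rewrite Hx; nra).
assert (H2 : x < (IZR n + 1) * (l1 + l2)) by (rewrite Hx; nra).
destruct (Req_dec x (IZR n * (l1 + l2))) as [E|E].
{ right; right; left; now exists n. }
destruct (Rtotal_order x (IZR n * (l1 + l2) + l2)) as [H|[H|H]].
- right; left; exists n; unfold patch2; lra.
- right; right; right; now exists n.
- left; exists (n + 1)%Z; unfold patch1; rewrite plus_IZR; lra.
Qed.

Section Problem.

Variables d1 d2 sigma l1 l2 : R.
Hypothesis Hd1 : 0 < d1.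
Hypothesis Hd2 : 0 < d2.
Hypothesis Hsigma : 0 < sigma.
Hypothesis Hl1 : 0 < l1.
Hypothesis Hl2 : 0 < l2.

(** The relation [rel] is [eq] for solutions, [Rle] for subsolutions, [Rge] for
    supersolutions and [Rgt] for strict ones. *)
Definition evolves (rel : R -> R -> Prop) (d : R) (f : R -> R) (u : R -> R -> R)
    (t x : R) : Prop :=
  exists ut ux uxx, is_derive (fun s => u s x) t ut /\ derive2 (u t) x ux uxx /\
    rel (ut - d * uxx) (f (u t x)).

(** Taking [(sm, sp)] equal to [(1, sigma)] on [S1] and to [(sigma, 1)] on [S2], a
    supersolution may have a concave kink in the weighted slopes: the side [Rge] is the
    same at both kinds of interface. *)
Definition transmits (rel : R -> R -> Prop) (sm sp : R) (g : R -> R) (x : R) : Prop :=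
  exists am ap, slope (at_left x) g x am /\ slope (at_right x) g x ap /\
    rel (sm * am) (sp * ap).

Definition satisfies (rel : R -> R -> Prop) (f1 f2 : R -> R) (u : R -> R -> R)
    (t x : R) : Prop :=
  (forall n, patch1 l1 l2 n x -> evolves rel d1 f1 u t x) /\
  (forall n, patch2 l1 l2 n x -> evolves rel d2 f2 u t x) /\
  (S1 l1 l2 x -> transmits rel 1 sigma (u t) x) /\
  (S2 l1 l2 x -> transmits rel sigma 1 (u t) x).

Lemma evolves_contact d f u w t x : 0 < d ->
  evolves Rle d f u t x -> evolves Rgt d f w t x -> 0 < t ->
  u t x = w t x -> (forall y, u t y <= w t y) ->
  (forall s, 0 <= s <= t -> u s x <= w s x) -> False.
Proof.
intros Hd [ut [ux [uxx [Hut [Hu Hue]]]]] [wt [wx [wxx [Hwt [Hw Hwe]]]]] Ht Heq Hx Hs.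
assert (H1 : wt <= ut).
{ apply (slope_left_contact (fun s => u s x) (fun s => w s x) t); trivial.
  - exists (mkposreal t Ht); intros s Hs1 Hs2; apply Hs.
    unfold ball in Hs1; simpl in Hs1; unfold AbsRing_ball, abs, minus, plus, opp in Hs1.
    simpl in Hs1; apply Rabs_def2 in Hs1; lra.
  - now apply slope_left_of_derive.
  - now apply slope_left_of_derive. }
assert (H2 : uxx <= wxx).
{ apply (derive2_contact (u t) (w t) x ux uxx wx wxx); trivial.
  now apply filter_forall. }
rewrite Heq in Hue.
assert (d * uxx <= d * wxx) by (apply Rmult_le_compat_l; lra).
lra.
Qed.

Lemma transmits_contact sm sp (g w : R -> R) x : 0 < sm -> 0 < sp ->
  transmits Rle sm sp g x -> transmits Rgt sm sp w x ->
  g x = w x -> (forall y, g y <= w y) -> False.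
Proof.
intros Hsm Hsp [am [ap [Ham [Hap Ha]]]] [bm [bp [Hbm [Hbp Hb]]]] Heq Hle.
assert (H1 : bm <= am).
{ apply (slope_left_contact g w x); trivial. now apply filter_forall. }
assert (H2 : ap <= bp).
{ apply (slope_right_contact g w x); trivial. now apply filter_forall. }
assert (sm * bm <= sm * am) by (apply Rmult_le_compat_l; lra).
assert (sp * ap <= sp * bp) by (apply Rmult_le_compat_l; lra).
lra.
Qed.

(** At a contact from below, [u] has the larger time derivative, the smaller second
    derivative, the larger left slope and the smaller right slope.  Each of the four
    conditions on [w] being strict, none of them is compatible with that on [u]. *)
Lemma no_contact f1 f2 u w t x :
  satisfies Rle f1 f2 u t x -> satisfies Rgt f1 f2 w t x -> 0 < t ->
  u t x = w t x -> (forall s y, 0 <= s <= t -> u s y <= w s y) -> False.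
Proof.
intros [Hu1 [Hu2 [Hu3 Hu4]]] [Hw1 [Hw2 [Hw3 Hw4]]] Ht Heq Hle.
assert (Hx : forall y, u t y <= w t y) by (intros y; apply Hle; lra).
destruct (patch_cover l1 l2 x Hl1 Hl2) as [[n Hn]|[[n Hn]|[Hn|Hn]]].
- apply (evolves_contact d1 f1 u w t x); eauto.
- apply (evolves_contact d2 f2 u w t x); eauto.
- apply (transmits_contact 1 sigma (u t) (w t) x); auto; lra.
- apply (transmits_contact sigma 1 (u t) (w t) x); auto; lra.
Qed.

End Problem.

Lemma satisfies_weaken (rel rel' : R -> R -> Prop) d1 d2 sigma l1 l2 f1 f2 u t x :
  (forall r s, rel r s -> rel' r s) ->
  satisfies d1 d2 sigma l1 l2 rel f1 f2 u t x ->
  satisfies d1 d2 sigma l1 l2 rel' f1 f2 u t x.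
Proof.
intros Hr [H1 [H2 [H3 H4]]]; split; [|split; [|split]].
- intros n Hn; destruct (H1 n Hn) as [ut [ux [uxx [A1 [A2 A3]]]]].
  exists ut, ux, uxx; auto.
- intros n Hn; destruct (H2 n Hn) as [ut [ux [uxx [A1 [A2 A3]]]]].
  exists ut, ux, uxx; auto.
- intros Hx; destruct (H3 Hx) as [am [ap [A1 [A2 A3]]]]; exists am, ap; auto.
- intros Hx; destruct (H4 Hx) as [am [ap [A1 [A2 A3]]]]; exists am, ap; auto.
Qed.

Lemma evolves_opp d f u t x :
  evolves eq d f u t x -> evolves eq d (fun s => - f (- s)) (fun t x => - u t x) t x.
Proof.
intros [ut [ux [uxx [A1 [A2 A3]]]]].
exists (- ut), (- ux), (- uxx); split; [|split].
- now apply (is_derive_opp (fun s => u s x)).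
- now apply derive2_opp.
- rewrite Ropp_involutive, <- A3; ring.
Qed.

Lemma transmits_opp sm sp (g : R -> R) x :
  transmits eq sm sp g x -> transmits eq sm sp (fun y => - g y) x.
Proof.
intros [am [ap [A1 [A2 A3]]]].
exists (- am), (- ap); split; [|split].
- apply slope_opp; [typeclasses eauto|assumption].
- apply slope_opp; [typeclasses eauto|assumption].
- lra.
Qed.

Lemma satisfies_opp d1 d2 sigma l1 l2 f1 f2 u t x :
  satisfies d1 d2 sigma l1 l2 eq f1 f2 u t x ->
  satisfies d1 d2 sigma l1 l2 eq (fun s => - f1 (- s)) (fun s => - f2 (- s))
    (fun t x => - u t x) t x.
Proof.
intros [H1 [H2 [H3 H4]]]; split; [|split; [|split]].
- intros n Hn; apply evolves_opp; eauto.
- intros n Hn; apply evolves_opp; eauto.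
- intros Hx; apply transmits_opp; auto.
- intros Hx; apply transmits_opp; auto.
Qed.

Lemma satisfies_const d1 d2 sigma l1 l2 f1 f2 M t x : f1 M <= 0 -> f2 M <= 0 ->
  satisfies d1 d2 sigma l1 l2 Rge f1 f2 (fun _ _ => M) t x.
Proof.
intros H1 H2.
assert (Hs : forall sm sp, transmits Rge sm sp (fun _ => M) x).
{ intros sm sp; exists 0, 0; split; [|split; [|lra]].
  - apply slope_left_of_derive, (is_derive_const M).
  - apply slope_right_of_derive, (is_derive_const M). }
split; [|split; [|split]]; intros.
- exists 0, 0, 0; split; [apply (is_derive_const M)|split; [apply derive2_const|lra]].
- exists 0, 0, 0; split; [apply (is_derive_const M)|split; [apply derive2_const|lra]].
- apply Hs.
- apply Hs.
Qed.

(** * The comparison principle *)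

(** For [mu1 > f1'(0)] and [mu2 < - f2'(0)] this is a positive strict supersolution,
    in each patch and across each interface, of the problem linearized at 0.  The number [Delta] measures by how much the flux
    condition is strict; it and the bounds [k], [Phi], [C] are what the barrier needs
    to be uniform in the length of the bistable patches. *)
Record weight (d1 d2 sigma l1 l2 mu1 mu2 Delta k Phi C : R) (phi : R -> R) : Prop := {
  weight_continuous : forall x, continuous phi x;
  weight_bounds : forall x, k <= phi x <= Phi;
  weight_patch1 : forall n x, patch1 l1 l2 n x ->
    exists a b, derive2 phi x a b /\ Rabs a <= C /\ d1 * b <= - mu1 * phi x;
  weight_patch2 : forall n x, patch2 l1 l2 n x ->
    exists a b, derive2 phi x a b /\ Rabs a <= C /\ d2 * b <= mu2 * phi x;
  weight_S1 : forall x, S1 l1 l2 x -> exists am ap,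
    slope (at_left x) phi x am /\ slope (at_right x) phi x ap /\ Delta <= am - sigma * ap;
  weight_S2 : forall x, S2 l1 l2 x -> exists am ap,
    slope (at_left x) phi x am /\ slope (at_right x) phi x ap /\ Delta <= sigma * am - ap
}.

Lemma is_derive_quadratic (nu x : R) :
  is_derive (fun y => 1 + nu ^ 2 * y ^ 2) x (2 * nu ^ 2 * x).
Proof. auto_derive; [trivial|ring]. Qed.

Lemma derive2_quadratic (nu x : R) :
  derive2 (fun y => 1 + nu ^ 2 * y ^ 2) x (2 * nu ^ 2 * x) (2 * nu ^ 2).
Proof.
exists (fun y => 2 * nu ^ 2 * y); split; [|split; [reflexivity|]].
- apply filter_forall; intros y; apply is_derive_quadratic.
- auto_derive; [trivial|ring].
Qed.

(** The growing factor [1 + nu ^ 2 * x ^ 2] has a logarithmic derivative of size at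
    most [nu], so it perturbs the flux jump of the weight as little as desired. *)
Lemma quadratic_slope (nu x : R) : 0 < nu ->
  Rabs (2 * nu ^ 2 * x) <= nu * (1 + nu ^ 2 * x ^ 2).
Proof.
intros Hnu; apply Rabs_le.
assert (H1 := pow2_ge_0 (nu * x - 1)); assert (H2 := pow2_ge_0 (nu * x + 1)).
split; nra.
Qed.

Lemma evolves_plus d f w p t x L :
  evolves Rge d f w t x ->
  (exists pt px pxx, is_derive (fun s => p s x) t pt /\ derive2 (p t) x px pxx /\
     L * p t x < pt - d * pxx) ->
  f (w t x + p t x) <= f (w t x) + L * p t x ->
  evolves Rgt d f (fun s y => w s y + p s y) t x.
Proof.
intros [wt [wx [wxx [Hwt [Hw Hwe]]]]] [pt [px [pxx [Hpt [Hp Hpe]]]]] Hf.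
exists (wt + pt), (wx + px), (wxx + pxx); split; [|split].
- now apply (is_derive_plus (fun s => w s x) (fun s => p s x)).
- now apply derive2_plus.
- lra.
Qed.

Lemma transmits_plus sm sp (g h : R -> R) x :
  transmits Rge sm sp g x -> transmits Rgt sm sp h x ->
  transmits Rgt sm sp (fun y => g y + h y) x.
Proof.
intros [am [ap [Ham [Hap Ha]]]] [bm [bp [Hbm [Hbp Hb]]]].
exists (am + bm), (ap + bp); split; [|split].
- now apply slope_plus; [typeclasses eauto| |].
- now apply slope_plus; [typeclasses eauto| |].
- lra.
Qed.

Lemma evolves_scal_exists d L e p t x : 0 < e ->
  (exists pt px pxx, is_derive (fun s => p s x) t pt /\ derive2 (p t) x px pxx /\
     L * p t x < pt - d * pxx) ->
  (exists pt px pxx, is_derive (fun s => e * p s x) t pt /\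
     derive2 (fun y => e * p t y) x px pxx /\ L * (e * p t x) < pt - d * pxx).
Proof.
intros He [pt [px [pxx [Hpt [Hp Hpe]]]]].
exists (e * pt), (e * px), (e * pxx); split; [|split].
- now apply (is_derive_scal (fun s => p s x)).
- now apply derive2_scal.
- apply (Rmult_lt_compat_l e) in Hpe; [lra|assumption].
Qed.

Lemma transmits_scal sm sp e (g : R -> R) x : 0 < e ->
  transmits Rgt sm sp g x -> transmits Rgt sm sp (fun y => e * g y) x.
Proof.
intros He [am [ap [Ham [Hap Ha]]]].
exists (e * am), (e * ap); split; [|split].
- apply slope_scal; [typeclasses eauto|assumption].
- apply slope_scal; [typeclasses eauto|assumption].
- apply Rgt_lt, (Rmult_lt_compat_l e) in Ha; [lra|assumption].
Qed.

Section Comparison.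

Variables d1 d2 sigma l1 l2 mu1 mu2 Delta k Phi C : R.
Variable phi : R -> R.
Hypothesis Hd1 : 0 < d1.
Hypothesis Hd2 : 0 < d2.
Hypothesis Hsigma : 0 < sigma.
Hypothesis Hl1 : 0 < l1.
Hypothesis Hl2 : 0 < l2.
Hypothesis Hmu1 : 0 < mu1.
Hypothesis Hmu2 : 0 < mu2.
Hypothesis HDelta : 0 < Delta.
Hypothesis Hk : 0 < k.
Hypothesis HC : 0 <= C.
Hypothesis Hphi : weight d1 d2 sigma l1 l2 mu1 mu2 Delta k Phi C phi.

Let HPhi : 0 < Phi.
Proof. destruct (weight_bounds _ _ _ _ _ _ _ _ _ _ _ _ Hphi 0); lra. Qed.

(** The perturbation that turns a supersolution into a strict one, large at
    infinity. *)
Definition growing_weight (nu K : R) (t x : R) : R :=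
  exp (K * t) * (phi x * (1 + nu ^ 2 * x ^ 2)).

Lemma growing_weight_pos nu K t x : k * exp (K * t) * (1 + nu ^ 2 * x ^ 2)
   <= growing_weight nu K t x.
Proof.
unfold growing_weight.
assert (H := exp_pos (K * t)).
destruct (weight_bounds _ _ _ _ _ _ _ _ _ _ _ _ Hphi x) as [H1 _].
assert (H2 := pow2_ge_0 (nu * x)).
replace (k * exp (K * t) * (1 + nu ^ 2 * x ^ 2)) with
  (exp (K * t) * (k * (1 + nu ^ 2 * x ^ 2))) by ring.
apply Rmult_le_compat_l; [lra|]. apply Rmult_le_compat_r; [nra|lra].
Qed.

(** For [K] large the time derivative of the exponential beats the diffusion of the
    spatial part and a Lipschitz reaction. *)
Lemma growing_weight_evolves d m nu K L a b t x :
  0 < d -> 0 < nu -> 0 <= m ->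
  derive2 phi x a b -> Rabs a <= C -> d * b <= m * phi x ->
  m + 2 * d * C * nu / k + 2 * d * nu ^ 2 + L < K ->
  exists pt px pxx, is_derive (fun s => growing_weight nu K s x) t pt /\
    derive2 (growing_weight nu K t) x px pxx /\
    L * growing_weight nu K t x < pt - d * pxx.
Proof.
intros Hd Hnu Hm Hab Ha Hb HK.
set (g := fun y => 1 + nu ^ 2 * y ^ 2).
set (E := exp (K * t)).
assert (HE : 0 < E) by apply exp_pos.
eexists; eexists; eexists; split; [|split].
- unfold growing_weight.
  apply (is_derive_ext (fun s => scal (phi x * g x) (exp (K * s)))).
    intros s; unfold scal; simpl; unfold mult; simpl; unfold g; ring.
  apply is_derive_scal, is_derive_exp_scal.
- unfold growing_weight; apply derive2_scal, derive2_mult; [exact Hab|].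
  apply derive2_quadratic.
- unfold growing_weight; fold E (g x).
  assert (Hg1 : 1 <= g x) by (assert (H := pow2_ge_0 (nu * x)); unfold g; nra).
  assert (Hgx := quadratic_slope nu x Hnu); fold (g x) in Hgx.
  destruct (weight_bounds _ _ _ _ _ _ _ _ _ _ _ _ Hphi x) as [Hk1 _].
  set (gx := 2 * nu ^ 2 * x) in *.
  set (P := phi x) in *.
  assert (HP : 0 < P) by lra.
  assert (Hcross : a * gx <= C * nu / k * (P * g x)).
  { apply Rle_trans with (Rabs a * Rabs gx).
    - rewrite <- Rabs_mult; apply Rle_abs.
    - apply Rle_trans with (C * (nu * g x)).
      + apply Rmult_le_compat; auto using Rabs_pos.
      + replace (C * nu / k * (P * g x)) with (C * (nu * g x) * (P / k)) by (field; lra).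
        rewrite <- (Rmult_1_r (C * (nu * g x))) at 1.
        apply Rmult_le_compat_l.
        * apply Rmult_le_pos; [lra|]. apply Rmult_le_pos; lra.
        * apply (Rmult_le_reg_r k); [lra|]. unfold Rdiv; rewrite Rmult_assoc, Rinv_l; lra. }
  assert (H1 : d * (b * g x) <= m * (P * g x)).
  { rewrite <- !Rmult_assoc; apply Rmult_le_compat_r; lra. }
  assert (H2 : d * (P * (2 * nu ^ 2)) <= 2 * d * nu ^ 2 * (P * g x)).
  { replace (d * (P * (2 * nu ^ 2))) with (2 * d * nu ^ 2 * (P * 1)) by ring.
    assert (0 < nu ^ 2) by nra.
    apply Rmult_le_compat_l; [nra|]. apply Rmult_le_compat_l; lra. }
  assert (H3 : d * (2 * (a * gx)) <= 2 * d * C * nu / k * (P * g x)).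
  { replace (2 * d * C * nu / k * (P * g x)) with (2 * d * (C * nu / k * (P * g x)))
      by (field; lra).
    replace (d * (2 * (a * gx))) with (2 * d * (a * gx)) by ring.
    apply Rmult_le_compat_l; lra. }
  assert (H4 : 0 < P * g x) by (apply Rmult_lt_0_compat; lra).
  assert (H5 : d * (b * g x + 2 * (a * gx) + P * (2 * nu ^ 2)) + L * (P * g x)
                 < K * (P * g x)).
  { apply Rle_lt_trans with
      ((m + 2 * d * C * nu / k + 2 * d * nu ^ 2 + L) * (P * g x)); [lra|].
    apply Rmult_lt_compat_r; assumption. }
  apply (Rmult_lt_compat_l E) in H5; [|assumption].
  unfold scal; simpl; unfold mult; simpl; fold E.
  lra.
Qed.

Lemma growing_weight_slope (F : (R -> Prop) -> Prop) {FF : Filter F} (nu K t x a : R) :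
  (forall P, locally' x P -> F P) -> slope F phi x a ->
  slope F (growing_weight nu K t) x
    (exp (K * t) * (a * (1 + nu ^ 2 * x ^ 2) + phi x * (2 * nu ^ 2 * x))).
Proof.
intros HF Ha; unfold growing_weight.
apply slope_scal; [exact FF|].
exact (slope_mult F phi _ x a _ HF Ha (is_derive_quadratic nu x)).
Qed.

(** The strict flux jump of the weight survives multiplication by a factor that
    varies slowly on the relative scale. *)
Lemma growing_weight_transmits nu K t x : 0 < nu -> Phi * nu * (1 + sigma) < Delta ->
  (S1 l1 l2 x -> transmits Rgt 1 sigma (growing_weight nu K t) x) /\
  (S2 l1 l2 x -> transmits Rgt sigma 1 (growing_weight nu K t) x).
Proof.
intros Hnu Hsmall.
assert (HE : 0 < exp (K * t)) by apply exp_pos.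
set (E := exp (K * t)) in *.
assert (Hgx := quadratic_slope nu x Hnu).
assert (Hg1 : 1 <= 1 + nu ^ 2 * x ^ 2) by (assert (H := pow2_ge_0 (nu * x)); nra).
destruct (weight_bounds _ _ _ _ _ _ _ _ _ _ _ _ Hphi x) as [Hk1 Hk2].
set (g := 1 + nu ^ 2 * x ^ 2) in *.
set (gx := 2 * nu ^ 2 * x) in *.
assert (Hpg : Rabs (phi x * gx) * (1 + sigma) < Delta * g).
{ rewrite Rabs_mult, (Rabs_pos_eq (phi x)) by lra.
  apply Rle_lt_trans with (Phi * nu * (1 + sigma) * g).
  - replace (Phi * nu * (1 + sigma) * g) with (Phi * (nu * g) * (1 + sigma)) by ring.
    apply Rmult_le_compat_r; [lra|].
    apply Rmult_le_compat; [lra|apply Rabs_pos|lra|lra].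
  - apply Rmult_lt_compat_r; lra. }
assert (Ho : - Rabs (phi x * gx) <= phi x * gx <= Rabs (phi x * gx)).
{ apply Rabs_le_between; lra. }
set (o := phi x * gx) in *; set (r := Rabs o) in *.
split; intros Hx.
- destruct (weight_S1 _ _ _ _ _ _ _ _ _ _ _ _ Hphi x Hx) as [am [ap [Ham [Hap Ha]]]].
  exists (E * (am * g + o)), (E * (ap * g + o)); split; [|split].
  + apply growing_weight_slope; [typeclasses eauto|apply locally'_of_left|exact Ham].
  + apply growing_weight_slope; [typeclasses eauto|apply locally'_of_right|exact Hap].
  + assert (Delta * g <= (am - sigma * ap) * g) by (apply Rmult_le_compat_r; lra).
    assert (0 < (am * g + o) - sigma * (ap * g + o)) by nra.
    nra.
- destruct (weight_S2 _ _ _ _ _ _ _ _ _ _ _ _ Hphi x Hx) as [am [ap [Ham [Hap Ha]]]].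
  exists (E * (am * g + o)), (E * (ap * g + o)); split; [|split].
  + apply growing_weight_slope; [typeclasses eauto|apply locally'_of_left|exact Ham].
  + apply growing_weight_slope; [typeclasses eauto|apply locally'_of_right|exact Hap].
  + assert (Delta * g <= (sigma * am - ap) * g) by (apply Rmult_le_compat_r; lra).
    assert (0 < sigma * (am * g + o) - (ap * g + o)) by nra.
    nra.
Qed.

Lemma growing_weight_continuous nu K : continuous_future (growing_weight nu K).
Proof.
apply continuous_future_mult.
- apply (continuous_future_time (fun t => exp (K * t))); intros t.
  apply (ex_derive_continuous (fun s => exp (K * s))).
  eexists; apply is_derive_exp_scal.
- apply continuous_future_mult.
  + apply continuous_future_space, (weight_continuous _ _ _ _ _ _ _ _ _ _ _ _ Hphi).
  + apply (continuous_future_space (fun x => 1 + nu ^ 2 * x ^ 2)); intros x.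
    apply (ex_derive_continuous (fun x => 1 + nu ^ 2 * x ^ 2)); auto_derive; trivial.
Qed.

(** Being a supersolution means here being touched from above by functions that
    satisfy the inequalities, which allows concave kinks.  It is enough: if
    [W + p] touches [u] from above, so does [w + p], and contact can occur only at
    heights that [u] reaches. *)
Lemma comparison f1 f2 u W T B L :
  0 <= L ->
  (forall s r, 0 <= s -> 0 <= r -> s + r <= B -> f1 (s + r) <= f1 s + L * r) ->
  (forall s r, 0 <= s -> 0 <= r -> s + r <= B -> f2 (s + r) <= f2 s + L * r) ->
  continuous_future u -> continuous_future W ->
  (forall x, u 0 x <= W 0 x) ->
  (forall t x, 0 <= t <= T -> u t x <= B) ->
  (forall t x, 0 < t -> satisfies d1 d2 sigma l1 l2 Rle f1 f2 u t x) ->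
  (forall t x, 0 <= W t x) ->
  (forall t x, 0 < t <= T -> W t x <= B -> exists w,
     (forall s y, W s y <= w s y) /\ w t x = W t x /\
     satisfies d1 d2 sigma l1 l2 Rge f1 f2 w t x) ->
  forall t x, 0 <= t <= T -> u t x <= W t x.
Proof.
intros HL Hf1 Hf2 Hcu HcW H0 HB Hu HW0 HW t x Ht.
(* half of the largest slope ratio that the flux jump tolerates *)
set (nu := Delta / (2 * (Phi * (1 + sigma)))).
assert (HPs : 0 < Phi * (1 + sigma)) by (apply Rmult_lt_0_compat; lra).
assert (Hnu : 0 < nu) by (apply Rdiv_lt_0_compat; lra).
assert (Hnu2 : Phi * nu * (1 + sigma) < Delta).
{ replace (Phi * nu * (1 + sigma)) with (Delta / 2); [lra|]. unfold nu; field; lra. }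
assert (Hq : forall d, 0 < d -> 0 <= 2 * d * C * nu / k + 2 * d * nu ^ 2).
{ intros d Hd. assert (0 <= 2 * d * C * nu / k).
  { apply Rmult_le_pos; [|apply Rlt_le, Rinv_0_lt_compat; lra].
    apply Rmult_le_pos; [|lra]. apply Rmult_le_pos; lra. }
  assert (0 <= 2 * d * nu ^ 2) by (apply Rmult_le_pos; [lra|apply pow2_ge_0]). lra. }
set (K := mu2 + (2 * d1 * C * nu / k + 2 * d1 * nu ^ 2)
              + (2 * d2 * C * nu / k + 2 * d2 * nu ^ 2) + L + 1).
assert (Hq1 := Hq d1 Hd1); assert (Hq2 := Hq d2 Hd2).
set (p := growing_weight nu K).
assert (HK0 : 0 < K) by (unfold K; lra).
assert (Hp0 : forall s y, 0 < p s y).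
{ intros s y; eapply Rlt_le_trans; [|apply growing_weight_pos].
  assert (H := exp_pos (K * s)). assert (H2 := pow2_ge_0 (nu * y)).
  apply Rmult_lt_0_compat; [apply Rmult_lt_0_compat; lra|nra]. }
assert (Hmain : forall e, 0 < e -> u t x <= W t x + e * p t x).
{ intros e He.
  assert (Hlt : 0 < (W t x + e * p t x) + - u t x); [|lra].
  set (N := (Rabs B / (e * k) + 1) / nu + 1).
  apply (first_contact (fun t x => (W t x + e * p t x) + - u t x) T N); [| | | |lra].
  - apply continuous_future_plus.
    + apply continuous_future_plus; [assumption|].
      apply continuous_future_mult; [|apply growing_weight_continuous].
      apply (continuous_future_time (fun _ => e)); intros; apply continuous_const.
    + now apply continuous_future_opp.
  - intros y. assert (H := Hp0 0 y). specialize (H0 y). nra.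
  (* far away the quadratic growth exceeds the bound B on u *)
  - intros s y Hs Hy.
    specialize (HB s y Hs). specialize (HW0 s y).
    assert (Hpy : k * (1 + nu ^ 2 * y ^ 2) <= p s y).
    { eapply Rle_trans; [|apply growing_weight_pos].
      assert (1 <= exp (K * s)).
      { rewrite <- exp_0. destruct (Req_dec s 0) as [->|]; [right; f_equal; ring|].
        apply Rlt_le, exp_increasing; nra. }
      assert (H2 := pow2_ge_0 (nu * y)).
      replace (k * (1 + nu ^ 2 * y ^ 2)) with (k * 1 * (1 + nu ^ 2 * y ^ 2)) by ring.
      apply Rmult_le_compat_r; [nra|]. apply Rmult_le_compat_l; lra. }
    assert (Hek : 0 < e * k) by (apply Rmult_lt_0_compat; lra).
    assert (HBk : 0 <= Rabs B / (e * k)).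
    { apply Rmult_le_pos; [apply Rabs_pos|]. apply Rlt_le, Rinv_0_lt_compat; lra. }
    assert (HN : Rabs B / (e * k) + 1 <= nu * Rabs y).
    { apply Rle_trans with (nu * N).
      - unfold N. rewrite Rmult_plus_distr_l.
        replace (nu * ((Rabs B / (e * k) + 1) / nu)) with (Rabs B / (e * k) + 1)
          by (field; lra). lra.
      - apply Rmult_le_compat_l; lra. }
    assert (Hsq : Rabs B / (e * k) + 1 <= nu ^ 2 * y ^ 2).
    { rewrite <- (pow2_abs y). 
      replace (nu ^ 2 * Rabs y ^ 2) with ((nu * Rabs y) * (nu * Rabs y)) by ring.
      nra. }
    assert (Hfin : Rabs B < e * (k * (1 + nu ^ 2 * y ^ 2))).
    { replace (Rabs B) with (e * (k * (Rabs B / (e * k)))) by (field; lra).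
      apply Rmult_lt_compat_l; [lra|]. apply Rmult_lt_compat_l; lra. }
    assert (HB' := Rle_abs B).
    assert (e * (k * (1 + nu ^ 2 * y ^ 2)) <= e * p s y) by (apply Rmult_le_compat_l; lra).
    lra.
  - intros s y Hs Heq Hge.
    assert (Hpy := Hp0 s y). assert (Hepy : 0 < e * p s y) by (apply Rmult_lt_0_compat; lra).
    assert (HBs := HB s y ltac:(lra)).
    assert (HW0y := HW0 s y).
    destruct (HW s y Hs ltac:(lra)) as [w [Hw1 [Hw2 Hw3]]].
    apply (no_contact d1 d2 sigma l1 l2 Hd1 Hd2 Hsigma Hl1 Hl2 f1 f2 u
             (fun s y => w s y + e * p s y) s y).
    + apply Hu; lra.
    + destruct Hw3 as [Hw31 [Hw32 [Hw33 Hw34]]].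
      destruct (growing_weight_transmits nu K s y Hnu Hnu2) as [Ht1 Ht2].
      split; [|split; [|split]].
      * intros n Hn.
        destruct (weight_patch1 _ _ _ _ _ _ _ _ _ _ _ _ Hphi n y Hn)
          as [a [b [Hab [Ha Hb]]]].
        apply (evolves_plus d1 f1 w (fun s y => e * p s y) s y L);
          [now apply (Hw31 n)| |rewrite Hw2; apply Hf1; lra].
        apply evolves_scal_exists; [assumption|].
        apply growing_weight_evolves with (m := 0) (a := a) (b := b); try assumption; try lra.
        -- destruct (weight_bounds _ _ _ _ _ _ _ _ _ _ _ _ Hphi y). nra.
        -- unfold K; lra.
      * intros n Hn.
        destruct (weight_patch2 _ _ _ _ _ _ _ _ _ _ _ _ Hphi n y Hn)
          as [a [b [Hab [Ha Hb]]]].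
        apply (evolves_plus d2 f2 w (fun s y => e * p s y) s y L);
          [now apply (Hw32 n)| |rewrite Hw2; apply Hf2; lra].
        apply evolves_scal_exists; [assumption|].
        apply growing_weight_evolves with (m := mu2) (a := a) (b := b); try assumption; try lra.
        unfold K; lra.
      * intros Hy; apply transmits_plus; [now apply Hw33|].
        apply transmits_scal; [assumption|now apply Ht1].
      * intros Hy; apply transmits_plus; [now apply Hw34|].
        apply transmits_scal; [assumption|now apply Ht2].
    + lra.
    + rewrite Hw2; lra.
    + intros s' z Hs'. specialize (Hge s' z Hs'). specialize (Hw1 s' z). lra. }
apply le_epsilon; intros eps Heps.
assert (Hp := Hp0 t x).
specialize (Hmain (eps / p t x) ltac:(apply Rdiv_lt_0_compat; lra)).
replace (eps / p t x * p t x) with eps in Hmain by (field; lra).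
lra.
Qed.

End Comparison.

(** * A periodic weight with a strict flux jump *)

(** The hypothesis is the strict inequality of the conclusion at the critical values
    [sqrt (a1 / d1)] and [sqrt (a2 / d2)]; continuity leaves room to enlarge [omega],
    then to lower [beta]. *)
Lemma subcritical_angle d1 d2 sigma a1 a2 l1 :
  0 < d1 -> 0 < d2 -> 0 < sigma -> 0 < a1 -> 0 < a2 ->
  0 < l1 < 2 * sqrt (d1 / a1) * atan (sigma * sqrt ((d1 * a2) / (d2 * a1))) ->
  exists omega beta, 0 < omega /\ 0 < beta /\ a1 < d1 * omega ^ 2 /\
    d2 * beta ^ 2 < a2 /\ omega * (l1 / 2) < PI / 2 /\
    omega * tan (omega * (l1 / 2)) < sigma * beta.
Proof.
intros Hd1 Hd2 Hs Ha1 Ha2 [Hl1 Hl].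
set (om0 := sqrt (a1 / d1)). set (be0 := sqrt (a2 / d2)).
set (q := sqrt (d1 * a2 / (d2 * a1))) in *.
assert (Hom0 : 0 < om0) by (apply sqrt_lt_R0, Rdiv_lt_0_compat; lra).
assert (Hbe0 : 0 < be0) by (apply sqrt_lt_R0, Rdiv_lt_0_compat; lra).
assert (Hinv : om0 * sqrt (d1 / a1) = 1).
{ unfold om0; rewrite <- sqrt_mult; [|apply Rlt_le, Rdiv_lt_0_compat; lra..].
  replace (a1 / d1 * (d1 / a1)) with 1 by (field; lra). apply sqrt_1. }
assert (Hq : om0 * q = be0).
{ assert (0 < d1 * a2) by (apply Rmult_lt_0_compat; lra).
  assert (0 < d2 * a1) by (apply Rmult_lt_0_compat; lra).
  unfold om0, q, be0; rewrite <- sqrt_mult; [|apply Rlt_le, Rdiv_lt_0_compat; lra..].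
  f_equal; field; lra. }
assert (Hang : om0 * (l1 / 2) < atan (sigma * q)).
{ apply (Rmult_lt_compat_l om0) in Hl; [|assumption].
  replace (om0 * (2 * sqrt (d1 / a1) * atan (sigma * q))) with
    (2 * (om0 * sqrt (d1 / a1)) * atan (sigma * q)) in Hl by ring.
  rewrite Hinv in Hl; lra. }
assert (Hat := atan_bound (sigma * q)).
assert (Hpos : 0 < om0 * (l1 / 2)) by (apply Rmult_lt_0_compat; lra).
assert (Htan : tan (om0 * (l1 / 2)) < sigma * q).
{ rewrite <- (tan_atan (sigma * q)). apply tan_increasing; lra. }
assert (H0 : om0 * tan (om0 * (l1 / 2)) < sigma * be0).
{ rewrite <- Hq. replace (sigma * (om0 * q)) with (om0 * (sigma * q)) by ring.
  now apply Rmult_lt_compat_l. }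
assert (Hcos : cos (om0 * (l1 / 2)) <> 0).
{ apply Rgt_not_eq, cos_gt_0; lra. }
assert (Hc : continuous (fun om => om * tan (om * (l1 / 2))) om0).
{ apply (ex_derive_continuous (fun om => om * tan (om * (l1 / 2)))).
  unfold tan; auto_derive; exact Hcos. }
assert (Hc2 : continuous (fun om => om * (l1 / 2)) om0).
{ apply (ex_derive_continuous (fun om => om * (l1 / 2))); auto_derive; trivial. }
assert (L1 : locally om0 (fun om => om * tan (om * (l1 / 2)) < sigma * be0))
  by exact (Hc _ (open_lt (sigma * be0) _ H0)).
assert (L2 : locally om0 (fun om => om * (l1 / 2) < PI / 2))
  by exact (Hc2 _ (open_lt (PI / 2) (om0 * (l1 / 2)) ltac:(lra))).
destruct (filter_and _ _ L1 L2) as [d Hd].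
assert (Hd0 := cond_pos d).
destruct (Hd (om0 + d / 2)) as [G1 G2].
{ unfold ball; simpl; unfold AbsRing_ball, abs, minus, plus, opp; simpl.
  rewrite Rabs_pos_eq; lra. }
set (om := om0 + d / 2) in *.
assert (Hom : om0 < om) by (unfold om; lra).
set (tau := om * tan (om * (l1 / 2))) in *.
assert (Htau : 0 < tau).
{ apply Rmult_lt_0_compat; [lra|]. apply tan_gt_0; [apply Rmult_lt_0_compat; lra|lra]. }
exists om, ((tau / sigma + be0) / 2).
assert (Htb : tau / sigma < be0).
{ apply (Rmult_lt_reg_r sigma); [lra|]. unfold Rdiv; rewrite Rmult_assoc, Rinv_l; lra. }
assert (Hts : 0 < tau / sigma) by (apply Rdiv_lt_0_compat; lra).
assert (Hom2 : om0 ^ 2 = a1 / d1).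
{ unfold om0; simpl; rewrite Rmult_1_r; apply sqrt_sqrt, Rlt_le, Rdiv_lt_0_compat; lra. }
assert (Hbe2 : be0 ^ 2 = a2 / d2).
{ unfold be0; simpl; rewrite Rmult_1_r; apply sqrt_sqrt, Rlt_le, Rdiv_lt_0_compat; lra. }
split; [lra|]; split; [lra|]; split; [|split; [|split; [lra|]]].
- replace a1 with (d1 * om0 ^ 2) by (rewrite Hom2; field; lra).
  apply Rmult_lt_compat_l; [lra|nra].
- replace a2 with (d2 * be0 ^ 2) by (rewrite Hbe2; field; lra).
  apply Rmult_lt_compat_l; [lra|nra].
- apply (Rle_lt_trans _ (sigma * (tau / sigma))).
  + right; unfold tau; field; lra.
  + apply Rmult_lt_compat_l; lra.
Qed.

(** Periodic function equal to [g2] on the patches of type 2 and to [g1] on those of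
    type 1, each measured from the left end of the patch. *)
Definition glue (l1 l2 : R) (g1 g2 : R -> R) (x : R) : R :=
  let r := x - IZR (Int_part (x / (l1 + l2))) * (l1 + l2) in
  if Rle_dec r l2 then g2 r else g1 (r - l2).

Section Glue.

Variables (l1 l2 : R) (g1 g2 : R -> R).
Hypothesis Hl1 : 0 < l1.
Hypothesis Hl2 : 0 < l2.
Hypothesis Hleft : g1 l1 = g2 0.
Hypothesis Hright : g2 l2 = g1 0.

Lemma Int_part_cell n x : IZR n * (l1 + l2) <= x < (IZR n + 1) * (l1 + l2) ->
  Int_part (x / (l1 + l2)) = n.
Proof.
intros Hx; symmetry; apply Int_part_spec.
assert (x = x / (l1 + l2) * (l1 + l2)) by (field; lra).
set (q := x / (l1 + l2)) in *. split; nra.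
Qed.

Lemma glue_patch2 n x : IZR n * (l1 + l2) <= x <= IZR n * (l1 + l2) + l2 ->
  glue l1 l2 g1 g2 x = g2 (x - IZR n * (l1 + l2)).
Proof.
intros Hx; unfold glue; rewrite (Int_part_cell n) by lra; cbv zeta.
destruct Rle_dec; [reflexivity|lra].
Qed.

Lemma glue_patch1 n x : IZR n * (l1 + l2) - l1 <= x <= IZR n * (l1 + l2) ->
  glue l1 l2 g1 g2 x = g1 (x - (IZR n * (l1 + l2) - l1)).
Proof.
intros Hx.
destruct (Req_dec x (IZR n * (l1 + l2))) as [E|E].
- rewrite (glue_patch2 n) by lra. rewrite E at 1 2.
  rewrite Rminus_diag, <- Hleft. f_equal; lra.
- unfold glue; rewrite (Int_part_cell (n - 1)); cbv zeta; rewrite minus_IZR; [|lra].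
  destruct Rle_dec.
  + assert (E' : x = IZR n * (l1 + l2) - l1) by lra. rewrite E'.
    replace (IZR n * (l1 + l2) - l1 - (IZR n - 1) * (l1 + l2)) with l2 by ring.
    rewrite Hright; f_equal; ring.
  + f_equal; ring.
Qed.

Lemma glue_bounds k Phi :
  (forall y, 0 <= y <= l1 -> k <= g1 y <= Phi) ->
  (forall y, 0 <= y <= l2 -> k <= g2 y <= Phi) ->
  forall x, k <= glue l1 l2 g1 g2 x <= Phi.
Proof.
intros H1 H2 x.
destruct (patch_cover l1 l2 x Hl1 Hl2) as [[n Hn]|[[n Hn]|[[n Hn]|[n Hn]]]].
- unfold patch1 in Hn; rewrite (glue_patch1 n) by lra. apply H1; lra.
- unfold patch2 in Hn; rewrite (glue_patch2 n) by lra. apply H2; lra.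
- rewrite (glue_patch2 n) by lra. apply H2; lra.
- rewrite (glue_patch2 n) by lra. apply H2; lra.
Qed.

Variables g1' g1'' g2' g2'' : R -> R.
Hypothesis Hg1 : forall y, is_derive g1 y (g1' y).
Hypothesis Hg1' : forall y, is_derive g1' y (g1'' y).
Hypothesis Hg2 : forall y, is_derive g2 y (g2' y).
Hypothesis Hg2' : forall y, is_derive g2' y (g2'' y).

Lemma glue_derive2_patch1 n x : patch1 l1 l2 n x ->
  derive2 (glue l1 l2 g1 g2) x (g1' (x - (IZR n * (l1 + l2) - l1)))
    (g1'' (x - (IZR n * (l1 + l2) - l1))).
Proof.
intros Hx; set (c := IZR n * (l1 + l2) - l1).
apply derive2_ext_loc with (fun y => g1 (y - c)).
- apply (locally_between c (c + l1) x); [unfold patch1, c in *; lra|].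
  intros y Hy; symmetry; apply glue_patch1; unfold c in Hy; lra.
- exists (fun y => g1' (y - c)); split; [|split; [reflexivity|]].
  + apply filter_forall; intros y; now apply is_derive_shift.
  + now apply is_derive_shift.
Qed.

Lemma glue_derive2_patch2 n x : patch2 l1 l2 n x ->
  derive2 (glue l1 l2 g1 g2) x (g2' (x - IZR n * (l1 + l2)))
    (g2'' (x - IZR n * (l1 + l2))).
Proof.
intros Hx; set (c := IZR n * (l1 + l2)).
apply derive2_ext_loc with (fun y => g2 (y - c)).
- apply (locally_between c (c + l2) x); [unfold patch2, c in *; lra|].
  intros y Hy; symmetry; apply glue_patch2; unfold c in Hy; lra.
- exists (fun y => g2' (y - c)); split; [|split; [reflexivity|]].
  + apply filter_forall; intros y; now apply is_derive_shift.
  + now apply is_derive_shift.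
Qed.

Lemma glue_left_of_S1 n : at_left (IZR n * (l1 + l2)) (fun y =>
  g1 (y - (IZR n * (l1 + l2) - l1)) = glue l1 l2 g1 g2 y).
Proof.
apply (at_left_between (IZR n * (l1 + l2) - l1) _); [lra|].
intros y Hy; symmetry; apply glue_patch1; lra.
Qed.

Lemma glue_right_of_S1 n : at_right (IZR n * (l1 + l2)) (fun y =>
  g2 (y - IZR n * (l1 + l2)) = glue l1 l2 g1 g2 y).
Proof.
apply (at_right_between (IZR n * (l1 + l2) + l2) _); [lra|].
intros y Hy; symmetry; apply glue_patch2; lra.
Qed.

Lemma glue_left_of_S2 n : at_left (IZR n * (l1 + l2) + l2) (fun y =>
  g2 (y - IZR n * (l1 + l2)) = glue l1 l2 g1 g2 y).
Proof.
apply (at_left_between (IZR n * (l1 + l2)) _); [lra|].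
intros y Hy; symmetry; apply glue_patch2; lra.
Qed.

Lemma glue_right_of_S2 n : at_right (IZR n * (l1 + l2) + l2) (fun y =>
  g1 (y - (IZR n * (l1 + l2) + l2)) = glue l1 l2 g1 g2 y).
Proof.
apply (at_right_between (IZR n * (l1 + l2) + l2 + l1) _); [lra|].
intros y Hy; rewrite (glue_patch1 (n + 1)); rewrite plus_IZR; [|lra].
f_equal; lra.
Qed.

Lemma glue_slopes_S1 n :
  slope (at_left (IZR n * (l1 + l2))) (glue l1 l2 g1 g2) (IZR n * (l1 + l2)) (g1' l1) /\
  slope (at_right (IZR n * (l1 + l2))) (glue l1 l2 g1 g2) (IZR n * (l1 + l2)) (g2' 0).
Proof.
set (c := IZR n * (l1 + l2)); split.
- apply slope_ext with (2 := glue_left_of_S1 n); [typeclasses eauto| |].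
  + symmetry; apply glue_patch1; unfold c; lra.
  + apply slope_left_of_derive, is_derive_shift.
    replace (c - (IZR n * (l1 + l2) - l1)) with l1 by (unfold c; ring). apply Hg1.
- apply slope_ext with (2 := glue_right_of_S1 n); [typeclasses eauto| |].
  + symmetry; apply glue_patch2; unfold c; lra.
  + apply slope_right_of_derive, is_derive_shift.
    replace (c - IZR n * (l1 + l2)) with 0 by (unfold c; ring). apply Hg2.
Qed.

Lemma glue_slopes_S2 n :
  slope (at_left (IZR n * (l1 + l2) + l2)) (glue l1 l2 g1 g2)
    (IZR n * (l1 + l2) + l2) (g2' l2) /\
  slope (at_right (IZR n * (l1 + l2) + l2)) (glue l1 l2 g1 g2)
    (IZR n * (l1 + l2) + l2) (g1' 0).
Proof.
set (c := IZR n * (l1 + l2) + l2); split.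
- apply slope_ext with (2 := glue_left_of_S2 n); [typeclasses eauto| |].
  + symmetry; apply glue_patch2; unfold c; lra.
  + apply slope_left_of_derive, is_derive_shift.
    replace (c - IZR n * (l1 + l2)) with l2 by (unfold c; ring). apply Hg2.
- apply slope_ext with (2 := glue_right_of_S2 n); [typeclasses eauto| |].
  + fold c; rewrite Rminus_diag, <- Hright. unfold c. rewrite (glue_patch2 n) by lra.
    f_equal; lra.
  + apply slope_right_of_derive, is_derive_shift.
    fold c; rewrite Rminus_diag. apply Hg1.
Qed.

Lemma glue_continuous x : continuous (glue l1 l2 g1 g2) x.
Proof.
destruct (patch_cover l1 l2 x Hl1 Hl2) as [[n Hn]|[[n Hn]|[[n Hn]|[n Hn]]]].
- eapply derive2_continuous, glue_derive2_patch1, Hn.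
- eapply derive2_continuous, glue_derive2_patch2, Hn.
- rewrite Hn; destruct (glue_slopes_S1 n); eapply continuous_sides; eassumption.
- rewrite Hn; destruct (glue_slopes_S2 n); eapply continuous_sides; eassumption.
Qed.

End Glue.

(** On a patch of type 1 the weight is a multiple of [cos (om * y)] centred in the
    patch; on a patch of type 2 it is [k + exp (- be * y) + exp (- be * (l2 - y))].  The
    constant [k] keeps the weight away from 0 in the middle of long patches.  It costs a
    little of the flux jump, as does the exponential arriving from the far end, and
    [Delta] is what remains. *)
Lemma weight_exists d1 d2 sigma a1 a2 l1 :
  0 < d1 -> 0 < d2 -> 0 < sigma -> 0 < a1 -> 0 < a2 ->
  0 < l1 < 2 * sqrt (d1 / a1) * atan (sigma * sqrt ((d1 * a2) / (d2 * a1))) ->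
  exists mu1 mu2 Delta k Phi C Lambda,
    a1 < mu1 /\ 0 < mu2 < a2 /\ 0 < Delta /\ 0 < k /\ 0 <= C /\ 0 < Lambda /\
    forall l2, Lambda <= l2 -> exists phi,
      weight d1 d2 sigma l1 l2 mu1 mu2 Delta k Phi C phi.
Proof.
intros Hd1 Hd2 Hs Ha1 Ha2 Hl1.
destruct (subcritical_angle d1 d2 sigma a1 a2 l1) as
  [om [be [Hom [Hbe [Hmu1 [Hmu2 [Hang Htau]]]]]]]; try assumption.
destruct Hl1 as [Hl1 _].
set (tau := om * tan (om * (l1 / 2))) in *.
assert (Hang0 : 0 < om * (l1 / 2)) by (apply Rmult_lt_0_compat; lra).
assert (Htau0 : 0 < tau) by (apply Rmult_lt_0_compat; [lra|apply tan_gt_0; lra]).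
set (c := cos (om * (l1 / 2))).
assert (Hc : 0 < c) by (apply cos_gt_0; lra).
assert (Hc1 : c <= 1) by apply COS_bound.
(* with E <= k, the flux jump is at least sigma be (1 - k) - (1 + 2 k) tau;
   this k spends half of the available sigma be - tau *)
set (k := (sigma * be - tau) / (2 * (2 * tau + sigma * be))).
assert (Hk : 0 < k) by (apply Rdiv_lt_0_compat; lra).
assert (HkD : k * (2 * tau + sigma * be) = (sigma * be - tau) / 2)
  by (unfold k; field; lra).
assert (Hk1 : k < 1).
{ apply (Rmult_lt_reg_r (2 * tau + sigma * be)); [lra|]. rewrite HkD; lra. }
set (Delta := sigma * be * (1 - k) - (1 + 2 * k) * tau).
assert (HDelta : 0 < Delta) by (unfold Delta; lra).
exists (d1 * om ^ 2), (d2 * be ^ 2), Delta, k, (3 / c), (3 * om / c + 2 * be), (/ (k * be)).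
assert (Hkbe : 0 < k * be) by (apply Rmult_lt_0_compat; lra).
assert (Hbe2 : 0 < be ^ 2) by nra.
assert (Hc3 : 3 <= 3 / c).
{ apply (Rmult_le_reg_r c); [lra|]. unfold Rdiv; rewrite Rmult_assoc, Rinv_l; lra. }
assert (Hoc : 0 < 3 * om / c) by (apply Rdiv_lt_0_compat; lra).
split; [assumption|]; split; [split; [nra|assumption]|].
split; [assumption|]; split; [assumption|]; split; [lra|].
split; [now apply Rinv_0_lt_compat|].
intros l2 Hl2.
assert (Hl20 : 0 < l2) by (apply Rlt_le_trans with (2 := Hl2), Rinv_0_lt_compat, Hkbe).
(* the exponential of one end seen from the other end of the patch *)
set (E := exp (- be * l2)).
assert (HE0 : 0 < E) by apply exp_pos.
assert (HEk : E <= k).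
{ assert (H1 : 1 / k <= exp (be * l2)).
  { apply Rle_trans with (1 + be * l2); [|apply exp_ineq1_le].
    apply Rle_trans with (be * l2); [|lra].
    apply (Rmult_le_compat_l be) in Hl2; [|lra].
    replace (be * / (k * be)) with (1 / k) in Hl2 by (field; lra). exact Hl2. }
  unfold E; replace (- be * l2) with (- (be * l2)) by ring. rewrite exp_Ropp.
  replace k with (/ (1 / k)) by (field; lra).
  apply Rinv_le_contravar; [apply Rdiv_lt_0_compat; lra|assumption]. }
set (H := 1 + E + k).
set (g1 := fun y => H / c * cos (om * (y - l1 / 2))).
set (g1' := fun y => - (H / c * om) * sin (om * (y - l1 / 2))).
set (g1'' := fun y => - om ^ 2 * g1 y).
set (g2 := fun y => k + exp (- be * y) + exp (- be * (l2 - y))).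
set (g2' := fun y => be * (exp (- be * (l2 - y)) - exp (- be * y))).
set (g2'' := fun y => be ^ 2 * (exp (- be * y) + exp (- be * (l2 - y)))).
assert (Dg1 : forall y, is_derive g1 y (g1' y)).
{ intros y; unfold g1, g1'; auto_derive; [trivial|]. unfold Rminus; ring. }
assert (Dg1' : forall y, is_derive g1' y (g1'' y)).
{ intros y; unfold g1', g1'', g1; auto_derive; [trivial|]. unfold Rminus; ring. }
assert (Dg2 : forall y, is_derive g2 y (g2' y)).
{ intros y; unfold g2, g2'; auto_derive; [trivial|]. unfold Rminus; ring. }
assert (Dg2' : forall y, is_derive g2' y (g2'' y)).
{ intros y; unfold g2', g2''; auto_derive; [trivial|]. unfold Rminus; ring. }
assert (Eleft : g1 l1 = g2 0).
{ unfold g1, g2. replace (om * (l1 - l1 / 2)) with (om * (l1 / 2)) by field. fold c.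
  rewrite Rmult_0_r, Rminus_0_r, exp_0; fold E; unfold H; field; lra. }
assert (Eright : g2 l2 = g1 0).
{ unfold g1, g2. replace (om * (0 - l1 / 2)) with (- (om * (l1 / 2))) by field.
  rewrite cos_neg; fold c.
  rewrite Rminus_diag, Rmult_0_r, exp_0; fold E; unfold H; field; lra. }
assert (HHc : 0 < H / c) by (apply Rdiv_lt_0_compat; unfold H; lra).
assert (HH3 : H / c <= 3 / c).
{ apply Rmult_le_compat_r; [now apply Rlt_le, Rinv_0_lt_compat|unfold H; lra]. }
assert (Hexp : forall y, 0 <= y -> 0 < exp (- be * y) <= 1).
{ intros y Hy; split; [apply exp_pos|]. rewrite <- exp_0.
  destruct (Req_dec y 0) as [->|]; [right; f_equal; ring|].
  apply Rlt_le, exp_increasing; nra. }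
exists (glue l1 l2 g1 g2); split.
- intros x; now apply glue_continuous with g1' g1'' g2' g2''.
- apply glue_bounds; try assumption.
  + intros y Hy; unfold g1; split.
    * assert (Hcy : c <= cos (om * (y - l1 / 2))).
      { unfold c. destruct (Rle_or_lt 0 (y - l1 / 2)) as [Hy1|Hy1].
        - apply cos_decr_1; try nra; assert (Hpi := PI_RGT_0); try lra; nra.
        - rewrite <- (cos_neg (om * (y - l1 / 2))).
          apply cos_decr_1; try nra; assert (Hpi := PI_RGT_0); try lra; nra. }
      apply Rle_trans with (H / c * c).
      -- replace (H / c * c) with H by (field; lra). unfold H; lra.
      -- apply Rmult_le_compat_l; lra.
    * apply Rle_trans with (H / c * 1); [|lra].
      apply Rmult_le_compat_l; [lra|apply COS_bound].
  + intros y Hy; unfold g2.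
    assert (H1 := Hexp y ltac:(lra)). assert (H2 := Hexp (l2 - y) ltac:(lra)). lra.
- intros n x Hx.
  eexists; eexists; split; [eapply glue_derive2_patch1; eassumption|split].
  + unfold g1'; rewrite Rabs_mult, Rabs_Ropp, Rabs_pos_eq;
      [|apply Rlt_le, Rmult_lt_0_compat; lra].
    apply Rle_trans with (H / c * om * 1).
    * apply Rmult_le_compat_l; [apply Rlt_le, Rmult_lt_0_compat; lra|].
      apply Rabs_le, SIN_bound.
    * apply Rle_trans with (3 / c * om); [rewrite Rmult_1_r; apply Rmult_le_compat_r; lra|].
      replace (3 / c * om) with (3 * om / c) by (field; lra). lra.
  + rewrite (glue_patch1 l1 l2 g1 g2 Hl1 Hl20 Eleft Eright n) by (unfold patch1 in Hx; lra).
    right; unfold g1''; ring.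
- intros n x Hx.
  eexists; eexists; split; [eapply glue_derive2_patch2; eassumption|].
  assert (Hx' := Hx); unfold patch2 in Hx'.
  set (y := x - IZR n * (l1 + l2)).
  assert (H1 := Hexp y ltac:(unfold y; lra)).
  assert (H2 := Hexp (l2 - y) ltac:(unfold y; lra)).
  split.
  + unfold g2'; apply Rabs_le; split; nra.
  + rewrite (glue_patch2 l1 l2 g1 g2 Hl1 Hl20 n) by lra. fold y.
    unfold g2'', g2. rewrite Rmult_assoc. apply Rmult_le_compat_l; [lra|].
    apply Rmult_le_compat_l; [lra|]. lra.
- intros x [n ->].
  destruct (glue_slopes_S1 l1 l2 g1 g2 Hl1 Hl20 Eleft Eright g1' g2' Dg1 Dg2 n) as [Hm Hp].
  exists (g1' l1), (g2' 0); split; [exact Hm|]; split; [exact Hp|].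
  unfold g1', g2'. replace (om * (l1 - l1 / 2)) with (om * (l1 / 2)) by field.
  rewrite Rmult_0_r, Rminus_0_r, exp_0; fold E.
  replace (- (H / c * om) * sin (om * (l1 / 2))) with (- H * tau)
    by (unfold tau, tan; fold c; field; lra).
  assert (H * tau <= (1 + 2 * k) * tau) by (apply Rmult_le_compat_r; unfold H; lra).
  assert (sigma * be * E <= sigma * be * k) by (apply Rmult_le_compat_l; nra).
  unfold Delta; lra.
- intros x [n ->].
  destruct (glue_slopes_S2 l1 l2 g1 g2 Hl1 Hl20 Eleft Eright g1' g2' Dg1 Dg2 n) as [Hm Hp].
  exists (g2' l2), (g1' 0); split; [exact Hm|]; split; [exact Hp|].
  unfold g1', g2'. replace (om * (0 - l1 / 2)) with (- (om * (l1 / 2))) by field.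
  rewrite Rminus_diag, Rmult_0_r, exp_0, sin_neg; fold E.
  replace (- (H / c * om) * - sin (om * (l1 / 2))) with (H * tau)
    by (unfold tau, tan; fold c; field; lra).
  assert (H * tau <= (1 + 2 * k) * tau) by (apply Rmult_le_compat_r; unfold H; lra).
  assert (sigma * be * E <= sigma * be * k) by (apply Rmult_le_compat_l; nra).
  unfold Delta; lra.
Qed.

(** * The retreating front *)

Lemma is_derive_mean (g g' : R -> R) (a b : R) : a <= b ->
  (forall x, is_derive g x (g' x)) -> exists c, a <= c <= b /\ g b - g a = g' c * (b - a).
Proof.
intros Hab Hg.
destruct (Rle_lt_or_eq_dec _ _ Hab) as [Hlt| ->].
- destruct (MVT_cor2 g g' a b Hlt) as [c [Hc1 Hc2]].
  + intros; now apply is_derive_Reals.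
  + exists c; split; [lra|assumption].
- exists b; split; [lra|ring].
Qed.

Lemma C1_lipschitz f B : Defs.C1 f ->
  exists L, 0 < L /\ forall s r, Rabs s <= B -> Rabs r <= B -> Rabs (f s - f r) <= L * Rabs (s - r).
Proof.
intros Hf.
destruct (Rlt_or_le B 0) as [HB|HB].
{ exists 1; split; [lra|]. intros s r Hs; assert (H := Rabs_pos s); lra. }
assert (Hc : forall c, - B <= c <= B -> continuity_pt (fun s => Rabs (Derive f s)) c).
{ intros c _; apply continuity_pt_filterlim.
  apply (continuous_comp (Derive f) Rabs); [apply Hf|apply continuous_Rabs]. }
destruct (continuity_ab_maj (fun s => Rabs (Derive f s)) (- B) B ltac:(lra) Hc)
  as [c [Hmax _]].
exists (Rabs (Derive f c) + 1); split; [assert (H := Rabs_pos (Derive f c)); lra|].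
assert (Hle : forall s r, s <= r -> - B <= s -> r <= B ->
   Rabs (f r - f s) <= (Rabs (Derive f c) + 1) * Rabs (r - s)).
{ intros s r Hsr Hs Hr.
  destruct (is_derive_mean f (Derive f) s r Hsr) as [e [He1 He2]].
  - intros x; apply Derive_correct, Hf.
  - rewrite He2, Rabs_mult; apply Rmult_le_compat_r; [apply Rabs_pos|].
    assert (H := Hmax e ltac:(lra)); simpl in H; lra. }
intros s r Hs Hr; apply Rabs_le_between in Hs; apply Rabs_le_between in Hr.
destruct (Rle_or_lt s r) as [H|H].
- rewrite Rabs_minus_sym, (Rabs_minus_sym s); apply Hle; lra.
- apply Hle; lra.
Qed.

Lemma is_derive_nonincreasing (g g' : R -> R) (a b : R) : a <= b ->
  (forall x, is_derive g x (g' x)) -> (forall x, a <= x <= b -> g' x <= 0) -> g b <= g a.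
Proof.
intros Hab Hg Hneg.
destruct (is_derive_mean g g' a b Hab Hg) as [c [Hc1 Hc2]].
specialize (Hneg c Hc1). nra.
Qed.

(** By continuity the derivative stays below [- gam] on a neighbourhood of 0. *)
Lemma linear_decay f gam : Defs.C1 f -> Derive f 0 < - gam ->
  exists s0, 0 < s0 /\ forall s r, 0 <= s -> 0 <= r -> s + r <= s0 ->
    f (s + r) <= f s - gam * r.
Proof.
intros Hf Hgam.
destruct (proj2 (Hf 0) _ (open_lt (- gam) _ Hgam)) as [d Hd].
assert (Hd0 := cond_pos d).
exists (d / 2); split; [lra|]. intros s r Hs Hr Hsr.
destruct (is_derive_mean f (Derive f) s (s + r) ltac:(lra)) as [e [He1 He2]].
{ intros x; apply Derive_correct, Hf. }
assert (He : Derive f e < - gam).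
{ apply Hd. unfold ball; simpl; unfold AbsRing_ball, abs, minus, plus, opp; simpl.
  rewrite Rabs_pos_eq; lra. }
nra.
Qed.

(** Separation of variables: [Y] is the inverse of the primitive [F] of [1 / p].  The
    bounds on [p] make [F] bi-Lipschitz, hence onto, and the mean value theorem for [F]
    gives the derivative of its inverse. *)
Lemma autonomous_ode (p : R -> R) (m C y0 : R) : 0 < m ->
  (forall y, continuous p y) -> (forall y, m <= p y <= C) ->
  exists Y : R -> R, Y 0 = y0 /\ forall z, is_derive Y z (p (Y z)).
Proof.
intros Hm Hp Hb.
assert (HC : 0 < C) by (specialize (Hb 0); lra).
assert (Hip : forall y, continuous (fun y => / p y) y).
{ intros y; apply (continuous_comp p Rinv); [apply Hp|].
  apply continuity_pt_filterlim. apply (continuity_pt_inv id).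
  - apply derivable_continuous_pt, derivable_pt_id.
  - unfold id; specialize (Hb y); lra. }
set (F := fun y => RInt (fun y => / p y) y0 y).
assert (HF : forall y, is_derive F y (/ p y)).
{ intros y; apply (is_derive_RInt (fun y => / p y) F y0); [|apply Hip].
  apply filter_forall; intros x; apply (RInt_correct (fun y => / p y)).
  apply ex_RInt_continuous; intros t _; apply Hip. }
assert (HF0 : F y0 = 0) by exact (RInt_point y0 (fun y => / p y)).
assert (Hinv : forall c, / C <= / p c <= / m).
{ intros c; specialize (Hb c); split; apply Rinv_le_contravar; lra. }
assert (HiC : 0 < / C) by now apply Rinv_0_lt_compat.
assert (Hgrow : forall x y, x <= y -> (y - x) / C <= F y - F x).
{ intros x y Hxy.
  destruct (is_derive_mean F (fun y => / p y) x y Hxy HF) as [c [_ ->]].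
  unfold Rdiv; rewrite Rmult_comm. apply Rmult_le_compat_r; [lra|apply Hinv]. }
assert (Hsurj : forall z, {y | F y = z}).
{ intros z.
  destruct (IVT_gen F (y0 - C * Rabs z) (y0 + C * Rabs z) z) as [y [_ Hy]]; [| |now exists y].
  - intros y; apply continuity_pt_filterlim, (ex_derive_continuous F).
    eexists; apply HF.
  - assert (Hz := Rabs_pos z).
    assert (Hcz : 0 <= C * Rabs z) by (apply Rmult_le_pos; lra).
    assert (H1 := Hgrow (y0 - C * Rabs z) y0 ltac:(lra)).
    assert (H2 := Hgrow y0 (y0 + C * Rabs z) ltac:(lra)).
    replace ((y0 - (y0 - C * Rabs z)) / C) with (Rabs z) in H1 by (field; lra).
    replace ((y0 + C * Rabs z - y0) / C) with (Rabs z) in H2 by (field; lra).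
    rewrite Rmin_left, Rmax_right by lra.
    assert (- Rabs z <= z <= Rabs z) by (apply Rabs_le_between; lra). lra. }
exists (fun z => proj1_sig (Hsurj z)).
assert (Hlip : forall z z', Rabs (proj1_sig (Hsurj z') - proj1_sig (Hsurj z)) <= C * Rabs (z' - z)).
{ intros z z'; destruct (Hsurj z) as [y Hy], (Hsurj z') as [y' Hy']; simpl.
  apply (Rmult_le_reg_r (/ C)); [assumption|].
  replace (C * Rabs (z' - z) * / C) with (Rabs (z' - z)) by (field; lra).
  destruct (Rle_or_lt y y') as [H|H].
  - assert (G := Hgrow _ _ H). rewrite (Rabs_pos_eq (y' - y)) by lra.
    unfold Rdiv in G; assert (G' := Rle_abs (z' - z)); lra.
  - assert (G := Hgrow _ _ (Rlt_le _ _ H)). rewrite Rabs_left by lra.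
    unfold Rdiv in G; assert (G' := Rle_abs (z - z')); rewrite Rabs_minus_sym; lra. }
split.
- destruct (Hsurj 0) as [y Hy]; simpl.
  destruct (Rle_or_lt y y0) as [H|H].
  + assert (G := Hgrow _ _ H). rewrite HF0, Hy in G. unfold Rdiv in G. nra.
  + assert (G := Hgrow _ _ (Rlt_le _ _ H)). rewrite HF0, Hy in G. unfold Rdiv in G. nra.
- intros z; apply is_derive_Reals; intros eps Heps.
  set (Y := fun z => proj1_sig (Hsurj z)).
  assert (HY : forall z, F (Y z) = z) by (intros z'; apply (proj2_sig (Hsurj z'))).
  destruct (proj1 (filterlim_locally _ _) (Hp (Y z)) (mkposreal eps Heps)) as [d Hd].
  assert (Hd0 := cond_pos d).
  assert (HdC : 0 < d / (C + 1)) by (apply Rdiv_lt_0_compat; lra).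
  exists (mkposreal _ HdC); intros h Hh Hhd; simpl in Hhd.
  change (Rabs ((Y (z + h) - Y z) / h - p (Y z)) < eps).
  assert (Hyd : Rabs (Y (z + h) - Y z) < d).
  { assert (G := Hlip z (z + h)). replace (z + h - z) with h in G by ring.
    change (Rabs (Y (z + h) - Y z) <= C * Rabs h) in G.
    apply Rle_lt_trans with (1 := G).
    apply Rle_lt_trans with ((C + 1) * Rabs h).
    - assert (H := Rabs_pos h); nra.
    - apply (Rmult_lt_compat_l (C + 1)) in Hhd; [|lra].
      replace ((C + 1) * (d / (C + 1))) with (pos d) in Hhd by (field; lra). exact Hhd. }
  assert (Hmean : exists c, Rabs (c - Y z) <= Rabs (Y (z + h) - Y z) /\
                    (Y (z + h) - Y z) / h = p c).
  { assert (Hq : forall c, h = / p c * (Y (z + h) - Y z) ->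
                  (Y (z + h) - Y z) / h = p c).
    { intros c Hc. specialize (Hb c).
      assert (E : Y (z + h) - Y z = p c * h).
      { transitivity (p c * (/ p c * (Y (z + h) - Y z))); [field; lra|now rewrite <- Hc]. }
      rewrite E; field; assumption. }
    destruct (Rle_or_lt (Y z) (Y (z + h))) as [H|H].
    - destruct (is_derive_mean F (fun y => / p y) _ _ H HF) as [c [Hc1 Hc2]].
      rewrite !HY in Hc2. exists c; split.
      + rewrite !Rabs_pos_eq; lra.
      + apply Hq; rewrite <- Hc2; ring.
    - destruct (is_derive_mean F (fun y => / p y) _ _ (Rlt_le _ _ H) HF) as [c [Hc1 Hc2]].
      rewrite !HY in Hc2. exists c; split.
      + rewrite (Rabs_left (Y (z + h) - Y z)) by lra. apply Rabs_le; lra.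
      + apply Hq. lra. }
  destruct Hmean as [c [Hc1 ->]].
  apply (Hd c). unfold ball; simpl; unfold AbsRing_ball, abs, minus, plus, opp; simpl.
  unfold Rminus in *; lra.
Qed.

(** Near 0 the linear part of [f] gives a quadratic bound.  Further away the
    potential decreases up to [theta], and beyond [theta] its maximum is its value at
    [K], which is negative. *)
Lemma negative_energy f theta K M : bistable f theta K -> RInt f 0 K < 0 -> 0 < M ->
  exists kap, 0 < kap /\ forall s, 0 <= s <= M -> RInt f 0 s <= - (2 * kap) * s ^ 2.
Proof.
intros [Hf [Hth [Hf0 [Hfth [HfK [Hd0 [_ [_ [Hneg Hpos]]]]]]]]] HK HM.
destruct (linear_decay f (- Derive f 0 / 2) Hf) as [s0 [Hs0 Hdec]]; [lra|].
set (gam := - Derive f 0 / 2) in *.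
assert (Hgam : 0 < gam) by (unfold gam; lra).
set (G := fun s => RInt f 0 s).
assert (Hcf : forall s, continuous f s).
{ intros s; apply (ex_derive_continuous f), Hf. }
assert (HG : forall s, is_derive G s (f s)).
{ intros s; apply (is_derive_RInt f G 0); [|apply Hcf].
  apply filter_forall; intros x; apply (RInt_correct f).
  apply ex_RInt_continuous; intros t _; apply Hcf. }
set (s1 := Rmin s0 theta).
assert (Hs1 : 0 < s1 /\ s1 <= s0 /\ s1 <= theta).
{ unfold s1; split; [apply Rmin_glb_lt; lra|]. split; [apply Rmin_l|apply Rmin_r]. }
assert (Hlow : forall s, 0 <= s <= s1 -> G s <= - (gam / 2) * s ^ 2).
{ intros s Hs.
  assert (H : G s + gam / 2 * s ^ 2 <= G 0 + gam / 2 * 0 ^ 2).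
  { apply (is_derive_nonincreasing (fun s => G s + gam / 2 * s ^ 2) (fun s => f s + gam * s));
      [lra| |].
    - intros x; apply (is_derive_plus G); [apply HG|].
      auto_derive; [trivial|field].
    - intros x Hx. assert (H := Hdec 0 x). rewrite Hf0, Rplus_0_l in H.
      specialize (H ltac:(lra) ltac:(lra) ltac:(lra)). lra. }
  assert (HG0 : G 0 = 0) by exact (RInt_point 0 f). rewrite HG0 in H. lra. }
set (h := Rmin (gam / 2 * s1 ^ 2) (- G K)).
assert (Hh : 0 < h).
{ apply Rmin_glb_lt; [apply Rmult_lt_0_compat; [lra|nra]|]. unfold G; lra. }
assert (Hh1 : h <= gam / 2 * s1 ^ 2) by apply Rmin_l.
assert (Hh2 : h <= - G K) by apply Rmin_r.
assert (Hhigh : forall s, s1 <= s -> G s <= - h).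
{ intros s Hs.
  destruct (Rle_or_lt s theta) as [H1|H1].
  - apply Rle_trans with (G s1).
    + apply (is_derive_nonincreasing G f); [assumption|assumption|].
      intros x Hx; destruct (Req_dec x theta) as [->|]; [lra|].
      apply Rlt_le, Hneg; lra.
    + specialize (Hlow s1 ltac:(lra)). lra.
  - apply Rle_trans with (G K); [|lra].
    destruct (Rle_or_lt s K) as [H2|H2].
    + apply Ropp_le_cancel.
      apply (is_derive_nonincreasing (fun s => - G s) (fun s => - f s)); [assumption| |].
      * intros x; apply (is_derive_opp G), HG.
      * intros x Hx; destruct (Req_dec x K) as [->|]; [lra|].
        assert (0 < f x); [apply Hpos; lra|lra].
    + apply (is_derive_nonincreasing G f); [lra|assumption|].
      intros x Hx; destruct (Req_dec x K) as [->|]; [lra|].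
      apply Rlt_le, Hneg; lra. }
exists (Rmin (gam / 4) (h / (2 * M ^ 2))).
assert (HM2 : 0 < M ^ 2) by nra.
split; [apply Rmin_glb_lt; [lra|apply Rdiv_lt_0_compat; lra]|].
intros s Hs; change (G s <= - (2 * Rmin (gam / 4) (h / (2 * M ^ 2))) * s ^ 2).
assert (K1 := Rmin_l (gam / 4) (h / (2 * M ^ 2))).
assert (K2 := Rmin_r (gam / 4) (h / (2 * M ^ 2))).
set (kap := Rmin (gam / 4) (h / (2 * M ^ 2))) in *.
assert (Hs2 : 0 <= s ^ 2) by apply pow2_ge_0.
destruct (Rle_or_lt s s1) as [H|H].
- specialize (Hlow s ltac:(lra)). nra.
- specialize (Hhigh s ltac:(lra)).
  assert (kap * s ^ 2 <= h / (2 * M ^ 2) * M ^ 2).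
  { assert (0 < h / (2 * M ^ 2)) by (apply Rdiv_lt_0_compat; lra).
    assert (s ^ 2 <= M ^ 2) by (apply pow_incr; lra).
    apply Rle_trans with (h / (2 * M ^ 2) * s ^ 2).
    - apply Rmult_le_compat_r; lra.
    - apply Rmult_le_compat_l; lra. }
  replace (h / (2 * M ^ 2) * M ^ 2) with (h / 2) in H0 by (field; lra).
  lra.
Qed.

(** With [Q s = - RInt f 0 s - kap * s ^ 2], the equation
    [U' = - sqrt (2 * Q U / d)] is solved in the variable [ln U]: since [Q s] is
    comparable to [s ^ 2], the logarithm moves at a speed between two positive constants,
    which keeps [U] positive, defined everywhere, and exponentially decaying.  Above
    the height [M + 1] the equation is continued with a constant logarithmic speed. *)
Lemma retreating_profile d f theta K M : 0 < d -> bistable f theta K ->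
  RInt f 0 K < 0 -> 0 < M ->
  exists kap m C Lam (U U' U'' : R -> R), 0 < kap /\ 0 < m /\ 0 < C /\ 0 < Lam /\
    U 0 = M /\
    (forall z, 0 < U z /\ is_derive U z (U' z) /\ - C * U z <= U' z <= - m * U z) /\
    (forall z, U z <= M -> is_derive U' z (U'' z) /\
       d * U'' z + f (U z) = - (2 * kap) * U z /\ U'' z <= Lam * U z).
Proof.
intros Hd Hbi HK HM.
destruct (negative_energy f theta K (M + 1) Hbi HK ltac:(lra)) as [kap [Hkap Hen]].
destruct Hbi as [Hf [_ [Hf0 _]]].
destruct (C1_lipschitz f (M + 1) Hf) as [L [HL Hlip]].
assert (HfL : forall s, 0 <= s <= M + 1 -> Rabs (f s) <= L * s).
{ intros s Hs. assert (H := Hlip s 0).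
  rewrite Hf0, !Rminus_0_r, Rabs_R0, (Rabs_pos_eq s) in H by lra. apply H; lra. }
set (G := fun s => RInt f 0 s).
assert (Hcf : forall s, continuous f s).
{ intros s; apply (ex_derive_continuous f), Hf. }
assert (HG : forall s, is_derive G s (f s)).
{ intros s; apply (is_derive_RInt f G 0); [|apply Hcf].
  apply filter_forall; intros x; apply (RInt_correct f).
  apply ex_RInt_continuous; intros t _; apply Hcf. }
assert (HG0 : G 0 = 0) by exact (RInt_point 0 f).
assert (HGlow : forall s, 0 <= s <= M + 1 -> - G s <= L * s ^ 2).
{ intros s Hs.
  destruct (is_derive_mean G f 0 s ltac:(lra) HG) as [c [Hc1 Hc2]].
  rewrite HG0, !Rminus_0_r in Hc2.
  assert (H := HfL c ltac:(lra)). apply Rabs_le_between in H. rewrite Hc2.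
  assert (L * c <= L * s) by (apply Rmult_le_compat_l; lra). nra. }
set (Q := fun s => - G s - kap * s ^ 2).
assert (HQ : forall s, is_derive Q s (- f s - 2 * kap * s)).
{ intros s; apply (is_derive_minus (fun s => - G s)); [apply (is_derive_opp G), HG|].
  auto_derive; [trivial|ring]. }
assert (HQb : forall s, 0 <= s <= M + 1 -> kap * s ^ 2 <= Q s <= L * s ^ 2).
{ intros s Hs. specialize (Hen s Hs). specialize (HGlow s Hs).
  assert (H := pow2_ge_0 s). change (RInt f 0 s) with (G s) in Hen.
  unfold Q; split; nra. }
set (P := fun s => sqrt (2 * Q s / d)).
(* S y is the height exp y, cut at M + 1; p is the logarithmic speed there *)
set (S := fun y => exp (Rmin y (ln (M + 1)))).
assert (HS : forall y, 0 < S y <= M + 1).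
{ intros y; split; [apply exp_pos|]. unfold S.
  apply Rle_trans with (exp (ln (M + 1))); [|rewrite exp_ln; lra].
  destruct (Req_dec (Rmin y (ln (M + 1))) (ln (M + 1))) as [->|Hne]; [lra|].
  apply Rlt_le, exp_increasing. assert (H := Rmin_r y (ln (M + 1))); lra. }
set (p := fun y => P (S y) / S y).
set (m := sqrt (2 * kap / d)). set (C := sqrt (2 * L / d)).
assert (Hm : 0 < m) by (apply sqrt_lt_R0, Rdiv_lt_0_compat; lra).
assert (HCp : 0 < C) by (apply sqrt_lt_R0, Rdiv_lt_0_compat; lra).
assert (Hid : 0 < / d) by now apply Rinv_0_lt_compat.
assert (HP : forall s, 0 < s <= M + 1 -> m * s <= P s <= C * s).
{ intros s Hs. specialize (HQb s ltac:(lra)).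
  assert (Es : s = sqrt (s ^ 2)) by (rewrite sqrt_pow2; lra).
  unfold m, C, P; split.
  - rewrite Es at 1. rewrite <- sqrt_mult_alt by (apply Rlt_le, Rdiv_lt_0_compat; lra).
    apply sqrt_le_1_alt. unfold Rdiv. nra.
  - rewrite Es at 2. rewrite <- sqrt_mult_alt by (apply Rlt_le, Rdiv_lt_0_compat; lra).
    apply sqrt_le_1_alt. unfold Rdiv. nra. }
assert (Hpb : forall y, m <= p y <= C).
{ intros y. specialize (HS y). specialize (HP (S y) HS). unfold p.
  split; apply (Rmult_le_reg_r (S y)); try lra; unfold Rdiv;
    rewrite Rmult_assoc, Rinv_l; lra. }
assert (Hpc : forall y, continuous p y).
{ intros y.
  assert (HSc : continuous S y).
  { unfold S. apply (continuous_comp (fun y => Rmin y (ln (M + 1))) exp).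
    - apply (continuous_ext (fun y => (y + ln (M + 1) - Rabs (y - ln (M + 1))) / 2)).
      { intros x; unfold Rmin, Rabs; destruct Rle_dec, Rcase_abs; lra. }
      apply continuity_pt_filterlim. reg.
    - apply (ex_derive_continuous exp). eexists; apply is_derive_exp. }
  apply (continuous_mult (fun y => P (S y)) (fun y => / S y)).
  - apply (continuous_comp S P); [exact HSc|].
    unfold P. apply (continuous_comp (fun s => 2 * Q s / d) sqrt).
    + apply (ex_derive_continuous (fun s => 2 * Q s / d)).
      exists (scal (2 / d) (- f (S y) - 2 * kap * S y)).
      apply (is_derive_ext (fun s => scal (2 / d) (Q s))).
      * intros t; unfold scal; simpl; unfold mult; simpl; field; lra.
      * now apply is_derive_scal.
    + apply continuous_sqrt.
  - apply (continuous_comp S Rinv); [exact HSc|].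
    apply continuity_pt_filterlim, (continuity_pt_inv id).
    + apply derivable_continuous_pt, derivable_pt_id.
    + unfold id. specialize (HS y). lra. }
destruct (autonomous_ode p m C (ln M) Hm Hpc Hpb) as [Y [HY0 HY]].
set (U := fun z => exp (Y (- z))).
set (U' := fun z => - p (Y (- z)) * U z).
assert (HU : forall z, is_derive U z (U' z)).
{ intros z; unfold U', U.
  replace (- p (Y (- z)) * exp (Y (- z))) with
    (scal (scal (-1) (p (Y (- z)))) (exp (Y (- z))))
    by (unfold scal; simpl; unfold mult; simpl; ring).
  apply (is_derive_comp exp (fun z => Y (- z))); [apply is_derive_exp|].
  apply (is_derive_comp Y (fun z => - z)); [apply HY|].
  auto_derive; [trivial|ring]. }
exists kap, m, C, ((L + 2 * kap) / d), U, U', (fun z => (- f (U z) - 2 * kap * U z) / d).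
assert (HU0 : forall z, 0 < U z) by (intros z; apply exp_pos).
split; [assumption|]; split; [assumption|]; split; [assumption|].
split; [apply Rdiv_lt_0_compat; lra|].
split; [unfold U; rewrite Ropp_0, HY0; now apply exp_ln|].
split; [intros z; split; [apply HU0|split; [apply HU|]]|].
{ specialize (HU0 z). specialize (Hpb (Y (- z))). unfold U'; split; nra. }
intros z Hz. split; [|split].
(* below the height M + 1 the cut in S is inactive, hence U' = - P U *)
- assert (Hloc : locally z (fun y => - P (U y) = U' y)).
  { assert (Hc : continuous U z) by (apply (ex_derive_continuous U); eexists; apply HU).
    assert (Hlt : locally z (fun y => U y < M + 1)).
    { exact (Hc _ (open_lt (M + 1) (U z) ltac:(lra))). }
    revert Hlt; apply filter_imp; intros y Hy.
    unfold U', p. replace (S (Y (- y))) with (U y).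
    - specialize (HU0 y). field; lra.
    - unfold S, U. rewrite Rmin_left; [reflexivity|].
      rewrite <- (ln_exp (Y (- y))). apply Rlt_le, ln_increasing; [apply exp_pos|exact Hy]. }
  apply is_derive_ext_loc with (1 := Hloc).
  assert (Hz0 := HU0 z).
  assert (HQ0 : 0 < Q (U z)).
  { specialize (HQb (U z) ltac:(lra)). assert (0 < (U z) ^ 2) by nra. nra. }
  assert (HP0 : 0 < P (U z)) by (specialize (HP (U z) ltac:(lra)); nra).
  assert (HP2 : 0 < 2 * Q (U z) / d) by (apply Rdiv_lt_0_compat; lra).
  assert (HU'z : U' z = - P (U z)) by (symmetry; exact (locally_singleton _ _ Hloc)).
  replace ((- f (U z) - 2 * kap * U z) / d) with
    (opp (scal (U' z) (scal (2 / d) (- f (U z) - 2 * kap * U z) / (2 * P (U z))))).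
  2:{ rewrite HU'z; unfold opp, scal; simpl; unfold mult; simpl; field; lra. }
  apply (is_derive_opp (fun y => P (U y))).
  apply (is_derive_comp P U); [|apply HU].
  apply (is_derive_sqrt (fun s => 2 * Q s / d)); [|exact HP2].
  apply (is_derive_ext (fun s => scal (2 / d) (Q s))).
  + intros t; unfold scal; simpl; unfold mult; simpl; field; lra.
  + apply is_derive_scal, HQ.
- field; lra.
- assert (H := HfL (U z)). assert (H0 := HU0 z).
  specialize (H ltac:(lra)). apply Rabs_le_between in H.
  replace ((L + 2 * kap) / d * U z) with ((L + 2 * kap) * U z / d) by (field; lra).
  apply Rmult_le_compat_r; nra.
Qed.

(** * Classical solutions satisfy the problem pointwise *)

Lemma is_derive_within_interior (a b : R) (g : R -> R) (x l : R) :
  a < x < b -> is_derive_within a b g x l -> is_derive g x l.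
Proof.
intros Hx [Hlin Hdom]; split; [exact Hlin|].
intros y Hy.
assert (Exy : x = y) by exact (is_filter_lim_locally_unique (V := R_NormedModule) x y Hy).
subst y; intros eps.
specialize (Hdom x ltac:(intros P [e He]; exists e; intros z Hz _; exact (He z Hz)) eps).
assert (Hab : locally x (fun y => a <= y <= b)) by now apply (locally_between a b x).
generalize (filter_and _ _ Hab Hdom); apply filter_imp; intros y [H1 H2]; now apply H2.
Qed.

Lemma is_derive_within_quotient (a b : R) (g : R -> R) (x l : R) :
  is_derive_within a b g x l ->
  filterlim (fun y => (g y - g x) / (y - x))
    (within (fun y => a <= y <= b /\ y <> x) (locally x)) (locally l).
Proof.
intros [Hlin Hdom]; apply filterlim_locally; intros eps.
assert (Heps : 0 < eps / 2) by (assert (H := cond_pos eps); lra).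
specialize (Hdom x ltac:(intros P [e He]; exists e; intros z Hz _; exact (He z Hz)) (mkposreal _ Heps)).
destruct Hdom as [e He]; exists e; intros y Hy0 [Hab Hne].
assert (Hy := He y Hy0 Hab); clear He Hy0.
simpl in Hy; unfold norm, minus, plus, opp, scal in Hy; simpl in Hy.
unfold mult, abs in Hy; simpl in Hy.
unfold ball; simpl; unfold AbsRing_ball, abs, minus, plus, opp; simpl.
assert (Hyx : y + - x <> 0) by (intros E; apply Hne; lra).
replace ((g y - g x) / (y - x) + - l) with ((g y + - g x + - ((y + - x) * l)) / (y + - x))
  by (field; exact Hyx).
unfold Rdiv; rewrite Rabs_mult, Rabs_inv.
assert (Hpos : 0 < Rabs (y + - x)) by now apply Rabs_pos_lt.
apply Rle_lt_trans with (eps / 2); [|lra].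
apply (Rmult_le_reg_r (Rabs (y + - x))); [assumption|].
rewrite Rmult_assoc, Rinv_l by lra. rewrite Rmult_1_r. exact Hy.
Qed.

Lemma is_derive_within_slope_left (a b : R) (g : R -> R) (l : R) :
  a < b -> is_derive_within a b g b l -> slope (at_left b) g b l.
Proof.
intros Hab Hg P HP.
assert (H := is_derive_within_quotient a b g b l Hg P HP).
assert (Hl : at_left b (fun y => a <= y <= b)) by now apply (at_left_between a b).
unfold filtermap, at_left, within in *.
generalize (filter_and _ _ Hl H); apply filter_imp; intros y [H1 H2] Hy.
apply H2; split; [now apply H1|lra].
Qed.

Lemma is_derive_within_slope_right (a b : R) (g : R -> R) (l : R) :
  a < b -> is_derive_within a b g a l -> slope (at_right a) g a l.
Proof.
intros Hab Hg P HP.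
assert (H := is_derive_within_quotient a b g a l Hg P HP).
assert (Hl : at_right a (fun y => a <= y <= b)) by now apply (at_right_between b a).
unfold filtermap, at_right, within in *.
generalize (filter_and _ _ Hl H); apply filter_imp; intros y [H1 H2] Hy.
apply H2; split; [now apply H1|lra].
Qed.

Lemma C12_interior a b u t x : C12 a b u -> 0 < t -> a < x < b ->
  exists ut ux uxx, is_derive (fun s => u s x) t ut /\ derive2 (u t) x ux uxx /\
    ut = Derive (fun s => u s x) t /\ uxx = Derive_n (u t) 2 x.
Proof.
intros [ut [ux [uxx [H _]]]] Ht Hx.
assert (Hint : forall y, a < y < b -> is_derive (u t) y (ux t y)).
{ intros y Hy; apply (is_derive_within_interior a b); [assumption|].
  apply H; lra. }
assert (Hloc : locally x (fun y => is_derive (u t) y (ux t y))).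
{ apply (filter_imp (fun y => a < y < b)); [exact Hint|].
  apply (locally_between ((a + x) / 2) ((x + b) / 2) x); [lra|]. intros y Hy; lra. }
assert (Hxx : is_derive (ux t) x (uxx t x)).
{ apply (is_derive_within_interior a b); [assumption|]. apply H; lra. }
exists (ut t x), (ux t x), (uxx t x); split; [apply H; lra|]; split; [|split].
- exists (ux t); auto.
- symmetry; apply is_derive_unique, H; lra.
- symmetry; simpl. rewrite <- (is_derive_unique _ _ _ Hxx).
  apply Derive_ext_loc. revert Hloc; apply filter_imp; intros y Hy.
  now apply is_derive_unique.
Qed.

(** The limit of the derivative from inside the patch is the value at the end point
    of the continuous derivative relative to the closed patch. *)
Lemma C12_slope_left a b u t v : a < b -> C12 a b u -> 0 < t ->
  filterlim (Derive (u t)) (at_left b) (locally v) -> slope (at_left b) (u t) b v.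
Proof.
intros Hab [ut [ux [uxx [H [_ [Hux _]]]]]] Ht Hv.
assert (E : v = ux t b).
{ apply (filterlim_locally_unique (F := at_left b) (Derive (u t))); [exact Hv|].
  apply filterlim_ext_loc with (ux t).
  - apply (filter_imp (fun y => a < y < b)).
    + intros y Hy; symmetry; apply is_derive_unique.
      apply (is_derive_within_interior a b); [assumption|]. apply H; lra.
    + assert (G : locally b (fun y => a < y)) by now apply open_gt.
      destruct G as [e He]; exists e; intros y Hy Hlt; specialize (He y Hy); lra.
  - intros P HP.
    destruct (Hux (t, b) ltac:(simpl; lra) P HP) as [e He].
    assert (G : locally b (fun y => a < y)) by now apply open_gt.
    assert (G2 : locally b (ball b e)) by apply locally_ball.
    destruct (filter_and _ _ G G2) as [e' He']; exists e'; intros y Hy Hlt.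
    destruct (He' y Hy) as [Hy1 Hy2].
    apply (He (t, y)); [split; [apply ball_center|exact Hy2]|simpl; lra]. }
rewrite E; apply (is_derive_within_slope_left a b); [assumption|]. apply H; lra.
Qed.

Lemma C12_slope_right a b u t v : a < b -> C12 a b u -> 0 < t ->
  filterlim (Derive (u t)) (at_right a) (locally v) -> slope (at_right a) (u t) a v.
Proof.
intros Hab [ut [ux [uxx [H [_ [Hux _]]]]]] Ht Hv.
assert (E : v = ux t a).
{ apply (filterlim_locally_unique (F := at_right a) (Derive (u t))); [exact Hv|].
  apply filterlim_ext_loc with (ux t).
  - apply (filter_imp (fun y => a < y < b)).
    + intros y Hy; symmetry; apply is_derive_unique.
      apply (is_derive_within_interior a b); [assumption|]. apply H; lra.
    + assert (G : locally a (fun y => y < b)) by now apply open_lt.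
      destruct G as [e He]; exists e; intros y Hy Hlt; specialize (He y Hy); lra.
  - intros P HP.
    destruct (Hux (t, a) ltac:(simpl; lra) P HP) as [e He].
    assert (G : locally a (fun y => y < b)) by now apply open_lt.
    assert (G2 : locally a (ball a e)) by apply locally_ball.
    destruct (filter_and _ _ G G2) as [e' He']; exists e'; intros y Hy Hlt.
    destruct (He' y Hy) as [Hy1 Hy2].
    apply (He (t, y)); [split; [apply ball_center|exact Hy2]|simpl; lra]. }
rewrite E; apply (is_derive_within_slope_right a b); [assumption|]. apply H; lra.
Qed.

Lemma solution_satisfies d1 d2 sigma f1 f2 l1 l2 u0 u t x : 0 < l1 -> 0 < l2 ->
  is_solution d1 d2 sigma f1 f2 l1 l2 u0 u -> 0 < t ->
  satisfies d1 d2 sigma l1 l2 eq f1 f2 u t x.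
Proof.
intros Hl1 Hl2 [_ [_ [_ [HC Hp]]]] Ht.
destruct (Hp t Ht) as [P1 [P2 [P3 P4]]].
split; [|split; [|split]].
- intros n Hn.
  destruct (C12_interior _ _ u t x (proj1 (HC n)) Ht Hn) as [ut [ux [uxx [H1 [H2 [H3 H4]]]]]].
  exists ut, ux, uxx; split; [|split]; trivial.
  rewrite H3, H4; now apply (P1 n).
- intros n Hn.
  destruct (C12_interior _ _ u t x (proj2 (HC n)) Ht Hn) as [ut [ux [uxx [H1 [H2 [H3 H4]]]]]].
  exists ut, ux, uxx; split; [|split]; trivial.
  rewrite H3, H4; now apply (P2 n).
- intros [n Hn].
  destruct (P3 x (ex_intro _ n Hn)) as [um [up [vm [vp [_ [[Hm Hp'] [_ E]]]]]]].
  exists vm, vp; rewrite Rmult_1_l; split; [|split; [|exact E]].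
  + subst x; apply (C12_slope_left (IZR n * (l1 + l2) - l1)); trivial; [lra|apply HC].
  + subst x; apply (C12_slope_right _ (IZR n * (l1 + l2) + l2)); trivial; [lra|apply HC].
- intros [n Hn].
  destruct (P4 x (ex_intro _ n Hn)) as [um [up [vm [vp [_ [[Hm Hp'] [_ E]]]]]]].
  exists vm, vp; rewrite Rmult_1_l; split; [|split; [|exact E]].
  + subst x; apply (C12_slope_left (IZR n * (l1 + l2))); trivial; [lra|apply HC].
  + assert (HC1 := proj1 (HC (n + 1)%Z)). rewrite plus_IZR in HC1.
    replace ((IZR n + 1) * (l1 + l2) - l1) with x in HC1 by lra.
    apply (C12_slope_right _ ((IZR n + 1) * (l1 + l2))); trivial. lra.
Qed.

(** * The barrier *)

Section Barrier.

Variables d1 d2 sigma l1 l2 mu1 mu2 Delta k Phi C : R.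
Variables f1 f2 phi U U' U'' : R -> R.
Variables a1 L gam s1 kap m Cp Lam M c lam eps del rho x0 : R.
Hypothesis Hd1 : 0 < d1.
Hypothesis Hsigma : 0 < sigma.
Hypothesis Hk : 0 < k.
Hypothesis Ha1 : 0 < a1.
Hypothesis HL : 0 < L.
Hypothesis Hgam : 0 < gam.
Hypothesis Hkap : 0 < kap.
Hypothesis Hm : 0 < m.
Hypothesis HCp : 0 < Cp.
Hypothesis HLam : 0 < Lam.
Hypothesis Hc : 0 < c.
Hypothesis Heps : 0 < eps.
Hypothesis HM : 0 < M.
Hypothesis Hphi : weight d1 d2 sigma l1 l2 mu1 mu2 Delta k Phi C phi.

Hypothesis Hf1 : forall s, 0 <= s -> f1 s <= a1 * s.
Hypothesis Hf2_lip : forall s r, 0 <= s -> 0 <= r -> s + r <= M -> f2 (s + r) <= f2 s + L * r.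
Hypothesis Hf2_decay : forall s r, 0 <= s -> 0 <= r -> s + r <= 2 * s1 ->
  f2 (s + r) <= f2 s - gam * r.

Hypothesis HU0 : U 0 = M.
Hypothesis HU : forall z,
  0 < U z /\ is_derive U z (U' z) /\ - Cp * U z <= U' z <= - m * U z.
Hypothesis HUM : forall z, U z <= M -> is_derive U' z (U'' z) /\
  d2 * U'' z + f2 (U z) = - (2 * kap) * U z /\ U'' z <= Lam * U z.

Hypothesis Hspeed : c * Cp <= kap.
Hypothesis Hlam_front : lam <= m * c.
Hypothesis Hlam1 : lam < mu1 - a1.
Hypothesis Hlam2 : lam <= gam - mu2.
Hypothesis Heps1 : eps * Phi <= s1.
Hypothesis Heps2 : (L + gam) * (eps * Phi) <= kap * s1.
Hypothesis Hdel : rho <= del.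
Hypothesis Hdel1 : (a1 + c * Cp + d1 * Lam) * (M * exp (- m * (del - rho)))
  <= (mu1 - a1 - lam) * (eps * k).
Hypothesis Hdel2 : (1 + sigma) * Cp * (M * exp (- m * (del - rho))) <= eps * Delta.
Hypothesis Hfar1 : forall n x, patch1 l1 l2 n x -> del <= Rabs (x - x0).
Hypothesis Hfar2 : forall x, S12 l1 l2 x -> del <= Rabs (x - x0).
Hypothesis Hlam : 0 < lam.

Lemma profile_decreasing z z' : z <= z' -> U z' <= U z.
Proof.
intros H; apply (is_derive_nonincreasing U U'); [assumption| |].
- intros x; apply HU.
- intros x _; destruct (HU x) as [H1 [_ H2]]; nra.
Qed.

Lemma profile_decay z : 0 <= z -> U z <= M * exp (- m * z).
Proof.
intros Hz.
assert (H : U z * exp (m * z) <= U 0 * exp (m * 0)).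
{ apply (is_derive_nonincreasing (fun z => U z * exp (m * z))
    (fun z => U' z * exp (m * z) + U z * (m * exp (m * z)))); [assumption| |].
  - intros x. apply (is_derive_mult U (fun z => exp (m * z))).
    + apply HU.
    + apply is_derive_exp_scal.
    + intros; apply Rmult_comm.
  - intros x _; destruct (HU x) as [H1 [_ H2]]; assert (H3 := exp_pos (m * x)); nra. }
rewrite Rmult_0_r, exp_0, HU0, Rmult_1_r in H.
replace (- m * z) with (- (m * z)) by ring. rewrite exp_Ropp.
assert (H3 := exp_pos (m * z)).
apply (Rmult_le_reg_r (exp (m * z))); [assumption|].
rewrite Rmult_assoc, Rinv_l; lra.
Qed.

Definition tail (t x : R) : R := eps * exp (- lam * t) * phi x.

(** The front to the right of [x0] for [s = 1], to its left for [s = -1]; both recede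
    towards [x0]. *)
Definition branch (s t x : R) : R := U (s * (x - x0) + (- rho + c * t)) + tail t x.

Definition barrier (t x : R) : R := U (Rabs (x - x0) + (- rho + c * t)) + tail t x.

Let E (t : R) := eps * exp (- lam * t).

Let HE t : 0 < E t.
Proof. apply Rmult_lt_0_compat; [assumption|apply exp_pos]. Qed.

Lemma tail_bounds t x : 0 <= t -> E t * k <= tail t x <= eps * Phi.
Proof.
intros Ht. destruct (weight_bounds _ _ _ _ _ _ _ _ _ _ _ _ Hphi x) as [H1 H2].
assert (H := HE t). change (tail t x) with (E t * phi x). split.
- apply Rmult_le_compat_l; lra.
- apply Rmult_le_compat; try lra.
  rewrite <- (Rmult_1_r eps). unfold E. apply Rmult_le_compat_l; [lra|].
  rewrite <- exp_0.
  destruct (Req_dec t 0) as [-> |]; [right; f_equal; ring|].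
  apply Rlt_le, exp_increasing; nra.
Qed.

Lemma barrier_ge_front t x : U (Rabs (x - x0) + (- rho + c * t)) <= barrier t x.
Proof.
destruct (weight_bounds _ _ _ _ _ _ _ _ _ _ _ _ Hphi x) as [H1 _].
assert (0 < tail t x).
{ change (0 < E t * phi x). apply Rmult_lt_0_compat; [apply HE|lra]. }
unfold barrier; lra.
Qed.

Lemma barrier_pos t x : 0 < barrier t x.
Proof.
apply Rlt_le_trans with (2 := barrier_ge_front t x), HU.
Qed.

Lemma barrier_le_branch s t x : s = 1 \/ s = -1 -> barrier t x <= branch s t x.
Proof.
intros Hs; unfold barrier, branch; apply Rplus_le_compat_r, profile_decreasing.
apply Rplus_le_compat_r. assert (H := Rle_abs (x - x0)).
assert (H' := Rle_abs (- (x - x0))); rewrite Rabs_Ropp in H'.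
destruct Hs as [-> | ->]; lra.
Qed.

(** On the KPP patches and at the interfaces the distance to [x0] is at least [del].
    There the front decays in time at the rate [m * c] because it recedes. *)
Lemma front_far t y : 0 <= t -> del <= y ->
  U (y + (- rho + c * t)) <= M * exp (- m * (del - rho)) * exp (- lam * t).
Proof.
intros Ht Hy.
apply Rle_trans with (U ((del - rho) + c * t)).
{ apply profile_decreasing; lra. }
apply Rle_trans with (M * exp (- m * ((del - rho) + c * t))).
{ apply profile_decay. assert (0 <= c * t) by (apply Rmult_le_pos; lra). lra. }
rewrite Rmult_assoc, <- exp_plus. apply Rmult_le_compat_l; [lra|].
assert (H : - m * (del - rho + c * t) <= - m * (del - rho) + - lam * t) by nra.
destruct H as [H|H]; [now apply Rlt_le, exp_increasing|rewrite H; lra].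
Qed.

Lemma branch_time s t x : is_derive (fun t => branch s t x) t
  (c * U' (s * (x - x0) + (- rho + c * t)) - lam * tail t x).
Proof.
replace (c * U' (s * (x - x0) + (- rho + c * t)) - lam * tail t x) with
  (scal c (U' (s * (x - x0) + (- rho + c * t))) + (eps * phi x) * (- lam * exp (- lam * t)))
  by (unfold tail, scal; simpl; unfold mult; simpl; ring).
unfold branch. apply (is_derive_plus (fun t => U (s * (x - x0) + (- rho + c * t)))).
- apply (is_derive_comp U (fun t => s * (x - x0) + (- rho + c * t))); [apply HU|].
  auto_derive; [trivial|ring].
- apply (is_derive_ext (fun t => (eps * phi x) * exp (- lam * t))).
  + intros y; change (eps * phi x * exp (- lam * y) = eps * exp (- lam * y) * phi x); ring.
  + apply (is_derive_scal (fun t => exp (- lam * t))), is_derive_exp_scal.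
Qed.

Lemma front_space s t y : is_derive (fun y => U (s * (y - x0) + (- rho + c * t))) y
  (s * U' (s * (y - x0) + (- rho + c * t))).
Proof.
apply (is_derive_comp U (fun y => s * (y - x0) + (- rho + c * t))); [apply HU|].
auto_derive; [trivial|ring].
Qed.

Lemma front_derive2 s t x : s = 1 \/ s = -1 -> U (s * (x - x0) + (- rho + c * t)) <= M ->
  derive2 (fun y => U (s * (y - x0) + (- rho + c * t))) x
    (s * U' (s * (x - x0) + (- rho + c * t))) (U'' (s * (x - x0) + (- rho + c * t))).
Proof.
intros Hs HzM.
exists (fun y => s * U' (s * (y - x0) + (- rho + c * t))); split; [|split; [reflexivity|]].
- apply filter_forall; intros y; apply front_space.
- replace (U'' (s * (x - x0) + (- rho + c * t))) with
    (s * (s * U'' (s * (x - x0) + (- rho + c * t)))) by (destruct Hs as [-> | ->]; ring).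
  apply (is_derive_scal (fun y => U' (s * (y - x0) + (- rho + c * t)))).
  apply (is_derive_comp U' (fun y => s * (y - x0) + (- rho + c * t))); [now apply HUM|].
  auto_derive; [trivial|ring].
Qed.

(** In a KPP patch the front is an error term, bounded by [front_far], that the
    margin [mu1 - a1 - lam] of the weight absorbs; at an interface the jump [Delta] does
    the same.  In a bistable patch the front has the surplus [kap * U]: it pays for the
    interaction with the tail when [U] exceeds [s1], and below [s1] the sum stays in the
    range where [f2] decays linearly. *)
Lemma branch_satisfies s t x : s = 1 \/ s = -1 -> 0 < t ->
  s * (x - x0) = Rabs (x - x0) -> branch s t x <= M ->
  satisfies d1 d2 sigma l1 l2 Rge f1 f2 (branch s) t x.
Proof.
intros Hs Ht Hx HMx.
set (z := s * (x - x0) + (- rho + c * t)).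
assert (Hz := HU z). destruct Hz as [HUz [_ HU'z]].
destruct (tail_bounds t x ltac:(lra)) as [Hq1 Hq2].
assert (HEt := HE t).
assert (HEk : 0 < E t * k) by (apply Rmult_lt_0_compat; lra).
set (q := tail t x) in *.
assert (Hbr : branch s t x = U z + q) by reflexivity.
assert (HUM' := HUM z ltac:(lra)). destruct HUM' as [_ [Hode HU''z]].
assert (Hfront := front_derive2 s t x Hs ltac:(fold z; lra)). fold z in Hfront.
assert (Htime := branch_time s t x). fold z q in Htime.
assert (HcU : - kap * U z <= c * U' z).
{ apply Rle_trans with (- (c * Cp) * U z); nra. }
assert (Hflux : S12 l1 l2 x -> (1 + sigma) * Rabs (s * U' z) <= E t * Delta).
{ intros HS.
  assert (HV := front_far t (s * (x - x0)) ltac:(lra) ltac:(rewrite Hx; now apply Hfar2)).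
  fold z in HV.
  assert (HR : Rabs (s * U' z) <= Cp * U z).
  { assert (U' z <= 0) by nra. apply Rabs_le; destruct Hs as [-> | ->]; lra. }
  apply Rle_trans with ((1 + sigma) * (Cp * U z)); [apply Rmult_le_compat_l; lra|].
  apply Rle_trans with
    ((1 + sigma) * (Cp * (M * exp (- m * (del - rho)) * exp (- lam * t)))).
  - apply Rmult_le_compat_l; [lra|]. apply Rmult_le_compat_l; lra.
  - replace (E t * Delta) with (eps * Delta * exp (- lam * t)) by (unfold E; ring).
    rewrite <- !Rmult_assoc. rewrite <- !Rmult_assoc in Hdel2.
    apply Rmult_le_compat_r; [apply Rlt_le, exp_pos|exact Hdel2]. }
assert (Hpm : - Rabs (s * U' z) <= s * U' z <= Rabs (s * U' z)) by (apply Rabs_le_between; lra).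
assert (Hsum : forall F, Filter F -> (forall P, locally' x P -> F P) -> forall a,
   slope F phi x a -> slope F (branch s t) x (s * U' z + E t * a)).
{ intros F FF HF a Ha. unfold branch.
  apply (slope_plus F (fun y => U (s * (y - x0) + (- rho + c * t))) (tail t)).
  - apply slope_of_derive; [exact FF|exact HF|apply front_space].
  - unfold tail. now apply slope_scal. }
split; [|split; [|split]].
- intros n Hn.
  destruct (weight_patch1 _ _ _ _ _ _ _ _ _ _ _ _ Hphi n x Hn) as [a [b [Hab [_ Hb]]]].
  exists (c * U' z - lam * q), (s * U' z + E t * a), (U'' z + E t * b).
  split; [exact Htime|]; split.
  + apply derive2_plus; [exact Hfront|]. unfold tail; now apply derive2_scal.
  + rewrite Hbr.
    assert (HV := front_far t (s * (x - x0)) ltac:(lra) ltac:(rewrite Hx; now apply (Hfar1 n))).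
    fold z in HV.
    assert (H1 := Hf1 (U z + q) ltac:(lra)).
    assert (H2 : (a1 + c * Cp + d1 * Lam) * U z <= (mu1 - a1 - lam) * q).
    { apply Rle_trans with ((a1 + c * Cp + d1 * Lam) *
        (M * exp (- m * (del - rho)) * exp (- lam * t))).
      - apply Rmult_le_compat_l; [|exact HV].
        assert (0 < c * Cp) by (apply Rmult_lt_0_compat; lra).
        assert (0 < d1 * Lam) by (apply Rmult_lt_0_compat; lra). lra.
      - apply Rle_trans with ((mu1 - a1 - lam) * (E t * k)); [|apply Rmult_le_compat_l; lra].
        replace ((mu1 - a1 - lam) * (E t * k)) with
          ((mu1 - a1 - lam) * (eps * k) * exp (- lam * t)) by (unfold E; ring).
        rewrite <- Rmult_assoc.
        apply Rmult_le_compat_r; [apply Rlt_le, exp_pos|exact Hdel1]. }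
    assert (H3 : d1 * U'' z <= d1 * Lam * U z)
      by (rewrite Rmult_assoc; apply Rmult_le_compat_l; lra).
    assert (H4 : d1 * (E t * b) <= - mu1 * q).
    { replace (- mu1 * q) with (E t * (- mu1 * phi x)) by (unfold q, tail, E; ring).
      replace (d1 * (E t * b)) with (E t * (d1 * b)) by ring.
      apply Rmult_le_compat_l; lra. }
    assert (H5 : - (c * Cp) * U z <= c * U' z) by nra.
    lra.
- intros n Hn.
  destruct (weight_patch2 _ _ _ _ _ _ _ _ _ _ _ _ Hphi n x Hn) as [a [b [Hab [_ Hb]]]].
  exists (c * U' z - lam * q), (s * U' z + E t * a), (U'' z + E t * b).
  split; [exact Htime|]; split.
  + apply derive2_plus; [exact Hfront|]. unfold tail; now apply derive2_scal.
  + rewrite Hbr.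
    assert (H4 : d2 * (E t * b) <= mu2 * q).
    { replace (mu2 * q) with (E t * (mu2 * phi x)) by (unfold q, tail, E; ring).
      replace (d2 * (E t * b)) with (E t * (d2 * b)) by ring.
      apply Rmult_le_compat_l; lra. }
    assert (H6 : (lam + mu2) * q <= gam * q) by (apply Rmult_le_compat_r; lra).
    assert (H7 : f2 (U z + q) <= f2 (U z) + kap * U z - gam * q).
    { assert (H0 : 0 < kap * U z) by (apply Rmult_lt_0_compat; lra).
      destruct (Rle_or_lt (U z) s1) as [Hlow|Hhigh].
      - assert (H := Hf2_decay (U z) q ltac:(lra) ltac:(lra) ltac:(lra)). lra.
      - assert (H := Hf2_lip (U z) q ltac:(lra) ltac:(lra) ltac:(lra)).
        assert ((L + gam) * q <= (L + gam) * (eps * Phi)) by (apply Rmult_le_compat_l; lra).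
        assert (kap * s1 <= kap * U z) by (apply Rmult_le_compat_l; lra).
        lra. }
    lra.
- intros HS. assert (Hf := Hflux (or_introl HS)).
  destruct (weight_S1 _ _ _ _ _ _ _ _ _ _ _ _ Hphi x HS) as [am [ap [Ham [Hap Ha]]]].
  exists (s * U' z + E t * am), (s * U' z + E t * ap); split; [|split].
  + apply Hsum; [typeclasses eauto|apply locally'_of_left|exact Ham].
  + apply Hsum; [typeclasses eauto|apply locally'_of_right|exact Hap].
  + assert (H1 : E t * Delta <= E t * (am - sigma * ap)) by (apply Rmult_le_compat_l; lra).
    assert (H2 : sigma * (s * U' z) <= sigma * Rabs (s * U' z)) by (apply Rmult_le_compat_l; lra).
    lra.
- intros HS. assert (Hf := Hflux (or_intror HS)).
  destruct (weight_S2 _ _ _ _ _ _ _ _ _ _ _ _ Hphi x HS) as [am [ap [Ham [Hap Ha]]]].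
  exists (s * U' z + E t * am), (s * U' z + E t * ap); split; [|split].
  + apply Hsum; [typeclasses eauto|apply locally'_of_left|exact Ham].
  + apply Hsum; [typeclasses eauto|apply locally'_of_right|exact Hap].
  + assert (H1 : E t * Delta <= E t * (sigma * am - ap)) by (apply Rmult_le_compat_l; lra).
    assert (H2 : sigma * (- Rabs (s * U' z)) <= sigma * (s * U' z))
      by (apply Rmult_le_compat_l; lra).
    lra.
Qed.

(** At [x] the branch of the side of [x0] on which [x] lies coincides with the
    barrier. *)
Lemma barrier_touched t x : 0 < t -> barrier t x <= M -> exists w,
  (forall s y, barrier s y <= w s y) /\ w t x = barrier t x /\
  satisfies d1 d2 sigma l1 l2 Rge f1 f2 w t x.
Proof.
intros Ht HMx.
assert (Hs : exists s, (s = 1 \/ s = -1) /\ s * (x - x0) = Rabs (x - x0)).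
{ destruct (Rle_or_lt 0 (x - x0)) as [H|H].
  - exists 1; split; [now left|]. rewrite Rabs_pos_eq; lra.
  - exists (-1); split; [now right|]. rewrite Rabs_left; lra. }
destruct Hs as [s [Hs Hsx]]; exists (branch s).
assert (Heq : branch s t x = barrier t x) by (unfold branch, barrier; now rewrite Hsx).
split; [intros; now apply barrier_le_branch|split; [assumption|]].
apply branch_satisfies; trivial; lra.
Qed.

Lemma barrier_continuous : continuous_future barrier.
Proof.
assert (Hexp : forall t, continuous (fun s => eps * exp (- lam * s)) t).
{ intros t; apply (ex_derive_continuous (fun s => eps * exp (- lam * s))).
  auto_derive; trivial. }
apply continuous_future_plus.
- apply (continuous_future_comp U (fun t x => Rabs (x - x0) + (- rho + c * t))).
  + intros r; apply (ex_derive_continuous U); exists (U' r); apply HU.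
  + apply (continuous_future_plus (fun _ x => Rabs (x - x0)) (fun t _ => - rho + c * t)).
    * apply (continuous_future_space (fun x => Rabs (x - x0))); intros x.
      apply (continuous_comp (fun x => x - x0) Rabs); [|apply continuous_Rabs].
      apply (ex_derive_continuous (fun x => x - x0)); auto_derive; trivial.
    * apply (continuous_future_time (fun t => - rho + c * t)); intros t.
      apply (ex_derive_continuous (fun t => - rho + c * t)); auto_derive; trivial.
- apply (continuous_future_mult (fun t _ => eps * exp (- lam * t)) (fun _ x => phi x)).
  + exact (continuous_future_time _ Hexp).
  + apply continuous_future_space, (weight_continuous _ _ _ _ _ _ _ _ _ _ _ _ Hphi).
Qed.

Lemma barrier_decay t x : 0 < t -> rho <= c * t ->
  barrier t x <= (M * exp (m * rho) / (m * c) + eps * Phi / lam) / t.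
Proof.
intros Ht Hrt.
assert (Hexp : forall a, 0 < a -> exp (- a * t) <= / (a * t)).
{ intros a Ha. replace (- a * t) with (- (a * t)) by ring. rewrite exp_Ropp.
  assert (0 < a * t) by (apply Rmult_lt_0_compat; lra).
  apply Rinv_le_contravar; [assumption|].
  assert (H' := exp_ineq1_le (a * t)); lra. }
assert (Hmc : 0 < m * c) by (apply Rmult_lt_0_compat; lra).
replace ((M * exp (m * rho) / (m * c) + eps * Phi / lam) / t) with
  (M * exp (m * rho) * / (m * c * t) + eps * Phi * / (lam * t)) by (field; lra).
assert (Hphi0 := weight_bounds _ _ _ _ _ _ _ _ _ _ _ _ Hphi x).
unfold barrier; apply Rplus_le_compat.
- apply Rle_trans with (U (- rho + c * t)).
  { apply profile_decreasing. assert (H := Rabs_pos (x - x0)); lra. }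
  apply Rle_trans with (M * exp (- m * (- rho + c * t))); [apply profile_decay; lra|].
  replace (- m * (- rho + c * t)) with (m * rho + - (m * c) * t) by ring.
  rewrite exp_plus, <- Rmult_assoc. apply Rmult_le_compat_l.
  + apply Rmult_le_pos; [lra|apply Rlt_le, exp_pos].
  + now apply Hexp.
- unfold tail. replace (eps * exp (- lam * t) * phi x) with (eps * phi x * exp (- lam * t)) by ring.
  apply Rmult_le_compat; try apply Rmult_le_compat_l; try lra.
  + apply Rmult_le_pos; lra.
  + apply Rlt_le, exp_pos.
  + now apply Hexp.
Qed.

End Barrier.

(** * Decay of the solution *)

(** The patch of type 1 lies beyond one of the two end points of the patch that
    contains [x0]. *)
Lemma patch1_far l1 l2 n0 x0 del : 0 < l1 -> 0 < l2 -> patch2 l1 l2 n0 x0 ->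
  (forall y, S12 l1 l2 y -> del <= Rabs (y - x0)) ->
  forall n x, patch1 l1 l2 n x -> del <= Rabs (x - x0).
Proof.
unfold patch1, patch2; intros Hl1 Hl2 Hx0 HS n x Hx.
destruct (Z_le_gt_dec n n0) as [Hn|Hn].
- apply IZR_le in Hn.
  assert (H := HS (IZR n0 * (l1 + l2)) (or_introl (ex_intro _ n0 eq_refl))).
  assert (IZR n * (l1 + l2) <= IZR n0 * (l1 + l2)) by (apply Rmult_le_compat_r; lra).
  rewrite Rabs_left in H by lra. rewrite Rabs_left; lra.
- assert (Hn' : (n0 + 1 <= n)%Z) by lia. apply IZR_le in Hn'; rewrite plus_IZR in Hn'.
  assert (H := HS (IZR n0 * (l1 + l2) + l2) (or_intror (ex_intro _ n0 eq_refl))).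
  assert ((IZR n0 + 1) * (l1 + l2) <= IZR n * (l1 + l2)) by (apply Rmult_le_compat_r; lra).
  rewrite Rabs_pos_eq in H by lra. rewrite Rabs_pos_eq; lra.
Qed.

Lemma increment_of_lipschitz f B L s r :
  (forall s r, Rabs s <= B -> Rabs r <= B -> Rabs (f s - f r) <= L * Rabs (s - r)) ->
  0 <= s -> 0 <= r -> s + r <= B ->
  f (s + r) <= f s + L * r /\ - f (- (s + r)) <= - f (- s) + L * r.
Proof.
intros H Hs Hr Hsr; split.
- specialize (H (s + r) s).
  rewrite (Rabs_pos_eq (s + r)), (Rabs_pos_eq s) in H by lra.
  replace (s + r - s) with r in H by ring. rewrite (Rabs_pos_eq r) in H by lra.
  specialize (H ltac:(lra) ltac:(lra)). apply Rabs_le_between in H. lra.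
- specialize (H (- (s + r)) (- s)).
  rewrite !Rabs_Ropp, (Rabs_pos_eq (s + r)), (Rabs_pos_eq s) in H by lra.
  replace (- (s + r) - - s) with (- r) in H by ring. rewrite Rabs_Ropp, (Rabs_pos_eq r) in H by lra.
  specialize (H ltac:(lra) ltac:(lra)). apply Rabs_le_between in H. lra.
Qed.

Lemma Glb_Rbar_le (E : R -> Prop) (a : Rbar) (r : R) : Rbar_le a (Glb_Rbar E) -> E r -> Rbar_le a r.
Proof.
intros Ha Hr; apply Rbar_le_trans with (1 := Ha), (proj1 (Glb_Rbar_correct E)), Hr.
Qed.

Lemma Lub_Rbar_ge (E : R -> Prop) (a : Rbar) (r : R) : Rbar_le (Lub_Rbar E) a -> E r -> Rbar_le r a.
Proof.
intros Ha Hr; apply Rbar_le_trans with (2 := Ha), (proj1 (Lub_Rbar_correct E)), Hr.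
Qed.

Section Bounds.

Variables d1 d2 sigma l1 l2 mu1 mu2 Delta k Phi C : R.
Variable phi f1 f2 : R -> R.
Hypothesis Hd1 : 0 < d1.
Hypothesis Hd2 : 0 < d2.
Hypothesis Hsigma : 0 < sigma.
Hypothesis Hl1 : 0 < l1.
Hypothesis Hl2 : 0 < l2.
Hypothesis Hmu1 : 0 < mu1.
Hypothesis Hmu2 : 0 < mu2.
Hypothesis HDelta : 0 < Delta.
Hypothesis Hk : 0 < k.
Hypothesis HC : 0 <= C.
Hypothesis Hphi : weight d1 d2 sigma l1 l2 mu1 mu2 Delta k Phi C phi.
Hypothesis Hf1 : Defs.C1 f1.
Hypothesis Hf2 : Defs.C1 f2.

Lemma C1_common_lipschitz B : exists L, 0 < L /\
  (forall s r, Rabs s <= B -> Rabs r <= B -> Rabs (f1 s - f1 r) <= L * Rabs (s - r)) /\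
  (forall s r, Rabs s <= B -> Rabs r <= B -> Rabs (f2 s - f2 r) <= L * Rabs (s - r)).
Proof.
destruct (C1_lipschitz f1 B Hf1) as [L1 [HL1 H1]].
destruct (C1_lipschitz f2 B Hf2) as [L2 [HL2 H2]].
exists (L1 + L2); split; [lra|]; split; intros s r Hs Hr; assert (H := Rabs_pos (s - r)).
- specialize (H1 s r Hs Hr). nra.
- specialize (H2 s r Hs Hr). nra.
Qed.

Lemma solution_le_const u0 u M : is_solution d1 d2 sigma f1 f2 l1 l2 u0 u ->
  0 <= M -> f1 M <= 0 -> f2 M <= 0 -> (forall x, u0 x <= M) ->
  forall t x, 0 <= t -> u t x <= M.
Proof.
intros Hu HM H1 H2 H0 t x Ht.
assert (Hu' := Hu). destruct Hu' as [Hc [Hb [Hi _]]].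
destruct (Hb (t + 1) ltac:(lra)) as [B HB].
destruct (C1_common_lipschitz B) as [L [HL [HL1 HL2]]].
apply (comparison d1 d2 sigma l1 l2 mu1 mu2 Delta k Phi C phi Hd1 Hd2 Hsigma Hl1 Hl2
         Hmu1 Hmu2 HDelta Hk HC Hphi f1 f2 u (fun _ _ => M) t B L); try lra.
- intros s r Hs Hr Hsr; now apply (increment_of_lipschitz f1 B).
- intros s r Hs Hr Hsr; now apply (increment_of_lipschitz f2 B).
- exact Hc.
- apply (continuous_future_time (fun _ => M)); intros; apply continuous_const.
- intros y; rewrite Hi; apply H0.
- intros s y Hs. apply Rle_trans with (1 := Rle_abs _), HB; lra.
- intros s y Hs. apply satisfies_weaken with (rel := eq); [intros; lra|].
  now apply solution_satisfies with u0.
- intros; assumption.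
- intros s y Hs _; exists (fun _ _ => M); split; [intros; lra|split; [reflexivity|]].
  now apply satisfies_const.
Qed.

(** The opposite of a solution solves the problem with the reactions
    [s |-> - f (- s)], to which the upper comparison with 0 applies. *)
Lemma solution_ge_0 u0 u : is_solution d1 d2 sigma f1 f2 l1 l2 u0 u ->
  f1 0 = 0 -> f2 0 = 0 -> (forall x, 0 <= u0 x) ->
  forall t x, 0 <= t -> 0 <= u t x.
Proof.
intros Hu H1 H2 H0 t x Ht.
assert (Hu' := Hu). destruct Hu' as [Hc [Hb [Hi _]]].
destruct (Hb (t + 1) ltac:(lra)) as [B HB].
destruct (C1_common_lipschitz B) as [L [HL [HL1 HL2]]].
assert (H : - u t x <= 0); [|lra].
apply (comparison d1 d2 sigma l1 l2 mu1 mu2 Delta k Phi C phi Hd1 Hd2 Hsigma Hl1 Hl2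
         Hmu1 Hmu2 HDelta Hk HC Hphi (fun s => - f1 (- s)) (fun s => - f2 (- s))
         (fun t x => - u t x) (fun _ _ => 0) t B L); try lra.
- intros s r Hs Hr Hsr; now apply (increment_of_lipschitz f1 B).
- intros s r Hs Hr Hsr; now apply (increment_of_lipschitz f2 B).
- apply continuous_future_opp; exact Hc.
- apply (continuous_future_time (fun _ => 0)); intros; apply continuous_const.
- intros y; rewrite Hi. specialize (H0 y); lra.
- intros s y Hs. apply Rle_trans with (1 := Rle_abs _). rewrite Rabs_Ropp. apply HB; lra.
- intros s y Hs. apply satisfies_weaken with (rel := eq); [intros; lra|].
  apply satisfies_opp. now apply solution_satisfies with u0.
- intros; lra.
- intros s y Hs _; exists (fun _ _ => 0); split; [intros; lra|split; [reflexivity|]].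
  apply satisfies_const; rewrite Ropp_0; lra.
Qed.

End Bounds.

Theorem theorem2p7 :
  forall (d1 d2 sigma : R) (f1 f2 : R -> R) (K1 K2 theta : R),
  0 < d1 -> 0 < d2 -> 0 < sigma ->
  kpp f1 K1 -> bistable f2 theta K2 ->
  RInt f2 0 K2 < 0 ->
  forall (rho A l1 : R),
  0 < rho -> 0 < A -> 0 < l1 < L1c d1 d2 sigma f1 f2 ->
  exists delta : R, 0 < delta /\
    forall l2 : R, rho + 2 * delta <= l2 ->
    forall (u0 : R -> R) (u : R -> R -> R),
    (forall x, 0 <= u0 x) ->
    (forall x, continuous u0 x) ->
    compact (supp u0) ->
    (exists x, u0 x <> 0) ->
    (exists n : Z, included (supp u0) (patch2 l1 l2 n)) ->
    Rbar_le (diam (supp u0)) rho ->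
    Rbar_le delta (dist_sets (supp u0) (S12 l1 l2)) ->
    Rbar_le (norm_Linf u0) A ->
    is_solution d1 d2 sigma f1 f2 l1 l2 u0 u ->
    forall eps : posreal,
      Rbar_locally p_infty (fun t => Rbar_lt (norm_Linf (u t)) eps).
Proof.
intros d1 d2 sigma f1 f2 K1 K2 theta Hd1 Hd2 Hsigma Hkpp Hbi HRI rho A l1 Hrho HA Hl1.
assert (Hkpp' := Hkpp); destruct Hkpp' as [Hf1 [HK1 [Hf10 [Hf1K [Hf1in [_ Hf1out]]]]]].
assert (Hbi' := Hbi).
destruct Hbi' as [Hf2 [Hth [Hf20 [_ [Hf2K [Hf2d [_ [_ [Hf2neg _]]]]]]]]].
set (a1 := Derive f1 0). set (a2 := - Derive f2 0).
assert (Ha1 : 0 < a1).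
{ assert (H := Hf1in (K1 / 2) ltac:(lra)); fold a1 in H.
  apply (Rmult_lt_reg_r (K1 / 2)); lra. }
assert (Ha2 : 0 < a2) by (unfold a2; lra).
assert (Hf1a : forall s, 0 <= s -> f1 s <= a1 * s).
{ intros s Hs. assert (0 <= a1 * s) by (apply Rmult_le_pos; lra).
  destruct (Rle_lt_or_eq_dec _ _ Hs) as [Hs'|E]; [|rewrite <- E in *; lra].
  destruct (Rtotal_order s K1) as [H1|[->|H1]].
  - apply Hf1in; lra.
  - lra.
  - specialize (Hf1out s (or_intror H1)); lra. }
destruct (weight_exists d1 d2 sigma a1 a2 l1) as
  [mu1 [mu2 [Delta [k [Phi [C [Lambda
    [Hmu1 [[Hmu2 Hmu2a] [HDelta [Hk [HC [HLambda Hweight]]]]]]]]]]]]]; trivial.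
{ unfold L1c in Hl1; fold a1 in Hl1. 
  replace (d1 * a2 / (d2 * a1)) with (- d1 * Derive f2 0 / (d2 * a1)); [exact Hl1|].
  unfold a2; field; lra. }
assert (HPhi : 0 < Phi).
{ destruct (Hweight Lambda (Rle_refl _)) as [phi Hphi].
  destruct (weight_bounds _ _ _ _ _ _ _ _ _ _ _ _ Hphi 0); lra. }
(* both reactions are nonpositive at M, so the solution stays below it *)
set (M := Rmax A (Rmax K1 K2)).
assert (HMA : A <= M) by apply Rmax_l.
assert (HM1 : K1 <= M) by (apply Rle_trans with (2 := Rmax_r _ _), Rmax_l).
assert (HM2 : K2 <= M) by (apply Rle_trans with (2 := Rmax_r _ _), Rmax_r).
assert (HMpos : 0 < M) by lra.
destruct (retreating_profile d2 f2 theta K2 M Hd2 Hbi HRI HMpos) as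
  [kap [m [Cp [Lam [U [U' [U'' [Hkap [Hm [HCp [HLam [HU0 [HU HUM]]]]]]]]]]]]].
set (gam := (mu2 + a2) / 2).
destruct (linear_decay f2 gam Hf2) as [s0 [Hs0 Hdec]]; [unfold gam, a2 in *; lra|].
set (s1 := s0 / 2).
destruct (C1_lipschitz f2 M Hf2) as [L [HL Hlip]].
(* the retreat uses half of the surplus 2 kap U, since |U'| <= Cp U *)
set (c := kap / Cp).
assert (Hc : 0 < c) by (apply Rdiv_lt_0_compat; lra).
assert (HcC : c * Cp = kap) by (unfold c; field; lra).
assert (Hmc : 0 < m * c) by (apply Rmult_lt_0_compat; lra).
(* slower than the decay of the front at a fixed point and than the margins of the weight *)
set (lam := Rmin (m * c) (Rmin ((mu1 - a1) / 2) (gam - mu2))).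
assert (Hlam : 0 < lam) by (unfold lam, gam; repeat apply Rmin_glb_lt; lra).
assert (Hlam1 : lam <= m * c) by apply Rmin_l.
assert (Hlam2 : lam <= (mu1 - a1) / 2) by (apply Rle_trans with (1 := Rmin_r _ _), Rmin_l).
assert (Hlam3 : lam <= gam - mu2) by (apply Rle_trans with (1 := Rmin_r _ _), Rmin_r).
assert (Hgam : 0 < gam) by (unfold gam; lra).
(* bound on the tail: small in the linear range, and small against the surplus
   kap s1 of a front of height at least s1 *)
set (e1 := Rmin s1 (kap * s1 / (L + gam))).
assert (Hks : 0 < kap * s1) by (apply Rmult_lt_0_compat; unfold s1; lra).
assert (He1 : 0 < e1)
  by (apply Rmin_glb_lt; [unfold s1; lra|apply Rdiv_lt_0_compat; lra]).
assert (He1s : e1 <= s1) by apply Rmin_l.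
assert (He1k : (L + gam) * e1 <= kap * s1).
{ replace (kap * s1) with ((L + gam) * (kap * s1 / (L + gam))) by (field; lra).
  apply Rmult_le_compat_l; [lra|apply Rmin_r]. }
set (e := e1 / Phi).
assert (He : 0 < e) by (apply Rdiv_lt_0_compat; lra).
assert (HeP : e * Phi = e1) by (unfold e; field; lra).
(* margins of the tail against total error caused by the front; exp y >= y makes
   the distance gap enough *)
set (small := Rmin (e * Delta) ((mu1 - a1 - lam) * (e * k))).
assert (Hsmall : 0 < small).
{ assert (0 < e * k) by (apply Rmult_lt_0_compat; lra).
  apply Rmin_glb_lt; apply Rmult_lt_0_compat; lra. }
set (big := ((1 + sigma) * Cp + (a1 + c * Cp + d1 * Lam)) * M).
assert (Hb1 : 0 < (1 + sigma) * Cp) by (apply Rmult_lt_0_compat; lra).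
assert (Hb2 : 0 < a1 + c * Cp + d1 * Lam)
  by (assert (0 < d1 * Lam) by (apply Rmult_lt_0_compat; lra); lra).
assert (Hbig : 0 < big) by (apply Rmult_lt_0_compat; lra).
set (gap := big / (small * m)).
assert (Hsm : 0 < small * m) by (apply Rmult_lt_0_compat; lra).
assert (Hgap : 0 < gap) by (apply Rdiv_lt_0_compat; lra).
set (del := rho + gap + Lambda).
assert (Hexp : big * exp (- m * (del - rho)) <= small).
{ replace (- m * (del - rho)) with (- (m * (gap + Lambda))) by (unfold del; ring).
  assert (Hmg : 0 < m * gap) by (apply Rmult_lt_0_compat; lra).
  assert (HmL : 0 < m * Lambda) by (apply Rmult_lt_0_compat; lra).
  rewrite exp_Ropp.
  assert (Hinv : / exp (m * (gap + Lambda)) <= / (m * gap)).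
  { apply Rinv_le_contravar; [assumption|].
    assert (H := exp_ineq1_le (m * (gap + Lambda))). lra. }
  apply Rle_trans with (big * / (m * gap)); [apply Rmult_le_compat_l; lra|].
  right; unfold gap; field; lra. }
assert (Hexp0 := exp_pos (- m * (del - rho))).
set (ex := exp (- m * (del - rho))) in *.
assert (HMex : 0 < M * ex) by (apply Rmult_lt_0_compat; lra).
assert (Hdel1 : (a1 + c * Cp + d1 * Lam) * (M * ex) <= (mu1 - a1 - lam) * (e * k)).
{ apply Rle_trans with small; [|apply Rmin_r].
  apply Rle_trans with (2 := Hexp). unfold big. nra. }
assert (Hdel2 : (1 + sigma) * Cp * (M * ex) <= e * Delta).
{ apply Rle_trans with small; [|apply Rmin_l].
  apply Rle_trans with (2 := Hexp). unfold big. nra. }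
exists del; split; [unfold del; lra|].
intros l2 Hl2 u0 u Hu0 _ _ [x0 Hx0] [n0 Hn0] Hdiam Hdist Hnorm Hsol eps.
assert (Hl20 : Lambda <= l2) by (unfold del in Hl2; lra).
assert (Hl2pos : 0 < l2) by lra.
destruct (Hweight l2 Hl20) as [phi Hphi].
destruct Hl1 as [Hl1 _].
assert (Hsupp : forall x, u0 x <> 0 -> supp u0 x).
{ intros x Hx; now apply adherence_P1. }
assert (Hfar2 : forall y, S12 l1 l2 y -> del <= Rabs (y - x0)).
{ intros y Hy. rewrite Rabs_minus_sym.
  apply (Glb_Rbar_le _ del (Rabs (x0 - y)) Hdist). exists x0, y; auto. }
assert (Hfar1 := patch1_far l1 l2 n0 x0 del Hl1 ltac:(lra) (Hn0 x0 (Hsupp x0 Hx0)) Hfar2).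
assert (Hu0A : forall x, u0 x <= A).
{ intros x; apply Rle_trans with (1 := Rle_abs _).
  apply (Lub_Rbar_ge _ A (Rabs (u0 x)) Hnorm). now exists x. }
assert (Hu0r : forall x, u0 x <> 0 -> Rabs (x - x0) <= rho).
{ intros x Hx. apply (Lub_Rbar_ge _ rho (Rabs (x - x0)) Hdiam). exists x, x0; auto. }
assert (Hf1M : f1 M <= 0).
{ destruct HM1 as [H|<-]; [|lra]. apply Rlt_le, Hf1out; now right. }
assert (Hf2M : f2 M <= 0).
{ destruct HM2 as [H|<-]; [|lra]. apply Rlt_le, Hf2neg; now right. }
assert (HuM : forall t x, 0 <= t -> u t x <= M).
{ apply (solution_le_const d1 d2 sigma l1 l2 mu1 mu2 Delta k Phi C phi f1 f2) with u0; try lra; trivial.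
  intros x; specialize (Hu0A x); lra. }
assert (Hu_pos : forall t x, 0 <= t -> 0 <= u t x).
{ apply (solution_ge_0 d1 d2 sigma l1 l2 mu1 mu2 Delta k Phi C phi f1 f2) with u0; try lra; trivial. }
set (W := barrier phi U c lam e rho x0).
assert (HWc : continuous_future W)
  by exact (barrier_continuous _ _ _ _ _ _ _ _ _ _ _ _ _ _ _ _ _ _ _ _ _ Hphi HU).
assert (HWpos : forall t x, 0 < W t x)
  by exact (barrier_pos _ _ _ _ _ _ _ _ _ _ _ _ _ _ _ _ _ _ _ _ _ Hk He Hphi HU).
assert (HuW : forall t x, 0 <= t -> u t x <= W t x).
{ intros t x Ht.
  destruct (C1_common_lipschitz f1 f2 Hf1 Hf2 M) as [L' [HL' [HL1 HL2]]].
  apply (comparison d1 d2 sigma l1 l2 mu1 mu2 Delta k Phi C phi) with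
    (f1 := f1) (f2 := f2) (T := t) (B := M) (L := L'); try lra; trivial.
  - intros s r Hs Hr Hsr; now apply (increment_of_lipschitz f1 M).
  - intros s r Hs Hr Hsr; now apply (increment_of_lipschitz f2 M).
  - apply Hsol.
  - intros x'. destruct Hsol as [_ [_ [Hi _]]]. rewrite Hi.
    destruct (Req_dec (u0 x') 0) as [->|Hx']; [apply Rlt_le, HWpos|].
    assert (HM' : M <= U (Rabs (x' - x0) + (- rho + c * 0))).
    { rewrite <- HU0. apply (profile_decreasing U U' m Cp Hm HU).
      specialize (Hu0r x' Hx'). lra. }
    apply Rle_trans with (1 := Hu0A x'), Rle_trans with (1 := HMA), Rle_trans with (1 := HM').
    apply (barrier_ge_front d1 d2 sigma l1 l2 mu1 mu2 Delta k Phi C); trivial.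
  - intros s y Hs; apply HuM; lra.
  - intros s y Hs. apply satisfies_weaken with (rel := eq); [intros; lra|].
    now apply solution_satisfies with u0.
  - intros s y; apply Rlt_le, HWpos.
  - intros s y Hs HWs.
    apply (barrier_touched d1 d2 sigma l1 l2 mu1 mu2 Delta k Phi C f1 f2 phi U U' U''
      a1 L gam s1 kap m Cp Lam M c lam e del rho x0); try lra; trivial.
    + intros s' r Hs' Hr Hsr; now apply (increment_of_lipschitz f2 M).
    + intros s' r Hs' Hr Hsr; apply Hdec; unfold s1 in Hsr; lra.
    + rewrite HeP; exact He1k.
    + unfold del; lra. }
assert (HWd : forall t x, 0 < t -> rho <= c * t ->
    W t x <= (M * exp (m * rho) / (m * c) + e * Phi / lam) / t).
{ exact (barrier_decay _ _ _ _ _ _ _ _ _ _ _ _ _ _ _ _ _ _ _ _ _ _ Hk Hm Hc He HMpos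
    Hphi HU0 HU Hlam). }
set (Q := M * exp (m * rho) / (m * c) + e * Phi / lam) in *.
assert (HQ : 0 < Q).
{ assert (0 < M * exp (m * rho)) by (apply Rmult_lt_0_compat; [lra|apply exp_pos]).
  assert (0 < M * exp (m * rho) / (m * c)) by (apply Rdiv_lt_0_compat; lra).
  assert (0 < e * Phi / lam) by (apply Rdiv_lt_0_compat; lra).
  unfold Q; lra. }
assert (Heps := cond_pos eps).
exists (Rmax (rho / c) (2 * Q / eps)); intros t Ht.
assert (Ht1 : rho / c < t) by (apply Rle_lt_trans with (2 := Ht), Rmax_l).
assert (Ht2 : 2 * Q / eps < t) by (apply Rle_lt_trans with (2 := Ht), Rmax_r).
assert (Hrc : 0 < rho / c) by (apply Rdiv_lt_0_compat; lra).
assert (Hct : rho <= c * t).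
{ apply Rle_trans with (c * (rho / c)); [right; field; lra|].
  apply Rmult_le_compat_l; lra. }
assert (HQt : Q / t <= eps / 2).
{ apply (Rmult_le_reg_r t); [lra|]. unfold Rdiv at 1; rewrite Rmult_assoc, Rinv_l, Rmult_1_r by lra.
  apply (Rmult_lt_compat_l (eps / 2)) in Ht2; [|lra].
  replace (eps / 2 * (2 * Q / eps)) with Q in Ht2 by (field; lra). lra. }
apply Rbar_le_lt_trans with (eps / 2); [|simpl; lra].
apply (proj2 (Lub_Rbar_correct (fun r => exists x, r = Rabs (u t x)))).
intros r [x ->]; simpl.
rewrite Rabs_pos_eq by (apply Hu_pos; lra).
apply Rle_trans with (1 := HuW t x ltac:(lra)).
specialize (HWd t x ltac:(lra) Hct); lra.
Qed.
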